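(* Let $c>0$, $T>0$, and let $u$ be the exact solution of the obstacle problem $\min(u_t+cu_x,\,u-g(x))=0$, $u(0,x)=u_0(x)$ on $(0,1)$ with periodic boundary conditions. Let $\ell\ge 0$ be an integer and assume that $u$ is not shattering on $[0,T]$, i.e. there are constants $p,L,c_0$ such that $u(t,\cdot)\in\mathcal C^{\ell+1}_{p,L,c_0}(0,1)$ for all $t\in[0,T]$. Let $\tilde g$ be either $g_{\Delta t}$ or $x\mapsto\max(g(x),g(x-c\Delta t))$. Let $u_h^0=\Pi_h u_0$ and, for $n\ge0$, let $u_h^{n+1}$ be the unique element of $V_h$ such that $$u_h^{n+1}(x^j_\alpha)=\max\big(G^{SL}_{\Delta t}(u_h^n)(x^j_\alpha),\ \tilde g(x^j_\alpha)\big),\qquad j=1,\dots,N,\ \alpha=0,\dots,k .$$ Write $u^n=u(t_n,\cdot)$, $t_n=n\Delta t$. Then there is a constant $C\ge 0$ independent of $n$ such that for all $n\ge0$ with $t_n\le T$ $$\|u_h^n-u^n\|\le CT\,\frac{h^{q_{k,\ell}}}{\Delta t}+CT\,\frac{\|\tilde g-g_{\Delta t}\|_{\ell^2}}{\Delta t}.$$ In particular: (i) if $\tilde g=g_{\Delta t}$, then for all $t_n\le T$, $\ \|u_h^n-u^n\|\le CT\,\dfrac{h^{q_{k,\ell}}}{\Delta t}$; (ii) if $\tilde g(x)=\max(g(x),g(x-c\Delta t))$ and $g\in\Delta^2_q(0,1)$ for some integer $q\geq 1$, then for all $t_n\le T$, $\ \|u_h^n-u^n\|\le CT\,\dfrac{h^{q_{k,\ell}}}{\Delta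 t}+CT\,\Delta t\sqrt{\Delta t+h}$.
   Context: Periodicity: all functions on $(0,1)$ are identified with their $1$-periodic extensions, and the function classes below are understood for periodic functions. The data $u_0,g$ are Lipschitz continuous. Exact solution: the (viscosity) solution is $u(0,\cdot)=u_0$ and, for $t>0$, $u(t,x)=\max\big(u_0(x-ct),\,g_t(x)\big)$, where $g_t(x):=\max_{\theta\in[0,t]}g(x-c\theta)$. Mesh and space: $I_j=(x_{j-1/2},x_{j+1/2})$, $j=1,\dots,N$, is a partition of $(0,1)$, $h_j=|I_j|$, $h=\max_j h_j$. For a fixed integer $k\ge 0$, $V_h$ is the space of functions whose restriction to each $I_j$ is a polynomial of degree at most $k$. $\Pi_h$ is the $L^2$ projection onto $V_h$, and $\|\cdot\|$ is the $L^2(0,1)$ norm. $\Delta t$ is the time step, with $0<\Delta t\le T$. Gauss points: $(x^j_\alpha)_{\alpha=0,\dots,k}$ are the $k+1$ Gauss-Legendre quadrature points on $I_j$, with quadrature weights $w^j_\alpha\geq 0$ normalized so that $\sum_\alpha w^j_\alpha=1$ (so the rule is $\int_{I_j}f\approx h_j\sum_\alpha w^j_\alpha f(x^j_\alpha)$). Pseudo-norm: $\|f\|_{\ell^2}:=\big(\sum_{j,\alpha}w^j_\alpha|f(x^j_\alpha)|^2h_j\big)^{1/2}$. Semi-Lagrangian DG (SLDG) operator: $G^{SL}_{\Delta t}(v):=\Pi_h\big(v(\cdot-c\Delta t)\big)$. Function classes: $\mathcal C^{\ell+1}_{p,L,c_0}(0,1)$ is the set of $v:(0,1)\to\mathbb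 R$ that are Lipschitz continuous with $\|v'\|_{L^\infty}\le L$, piecewise $C^{\ell+1}$ with $\|v^{(\ell+1)}\|_{L^\infty}\le c_0$ (the derivative being taken almost everywhere), and have at most $p\ge 0$ non-regular points (points near which $v$ is not $C^{\ell+1}$). $\Delta^2_q(0,1)$ is the set of $g:(0,1)\to\mathbb R$ having at most $q$ local maximum points and twice differentiable at each local maximum. Exponent: $q_{k,\ell}:=\min\big(\min(k,\ell)+1,\tfrac32\big)$, i.e. $3/2$ if $k,\ell\ge1$ and $1$ if $k=0$ or $\ell=0$. Constants $C$ depend only on the exact solution and data (and the fixed $c,k,\ell$), in particular not on $n$, $h$, the mesh or $\Delta t$; they may differ between occurrences. *)

(* Defs.v *)
From HB Require Import structures.
From mathcomp Require Import all_boot all_order all_algebra.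
From mathcomp Require Import all_classical all_reals all_analysis.

Set Implicit Arguments.
Unset Strict Implicit.
Unset Printing Implicit Defensive.

Import Order.TTheory GRing.Theory Num.Theory.
Import numFieldNormedType.Exports.

Local Open Scope classical_set_scope.
Local Open Scope ring_scope.

(* Functions on (0,1) with periodic boundary conditions are 1-periodic
   functions R -> R; a set of points of the circle is counted in [0,1[. *)

(* For continuous [g] and [0 <= t] the supremum is attained, so this is the
   maximum of g(x - c s) over s in [0,t]. *)
Definition running_max (R : realType) (c : R) (g : R -> R) (t x : R) : R :=
  sup [set g (x - c * s) | s in `[0, t]].

(* Closed form of the viscosity solution of min(u_t + c u_x, u - g) = 0,
   u(0,.) = u0, for t >= 0. *)
Definition exact_sol (R : realType) (c : R) (u0 g : R -> R) (t x : R) : R :=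
  if t == 0 then u0 x else Num.max (u0 (x - c * t)) (running_max c g t x).

Definition regular_at (R : realType) (m : nat) (v : R -> R) (x : R) : Prop :=
  \forall y \near x,
    (forall i, (i < m)%N -> derivable (derive1n i v) y 1) /\
    {for y, continuous (derive1n m v)}.

(* Periodic version of C^{l+1}_{p,L,c0}(0,1): piecewise C^{l+1} means C^{l+1}
   near every point of the circle except at most [p] of them. *)
Definition piecewise_regular (R : realType) (l p : nat) (L c0 : R)
    (v : R -> R) : Prop :=
  [/\ lipschitz v,
      {ae lebesgue_measure, forall x : R, 0 < x < 1 ->
         derivable v x 1 /\ `|derive1 v x| <= L},
      {ae lebesgue_measure, forall x : R, 0 < x < 1 ->
         `|derive1n l.+1 v x| <= c0} &
      ([set x | 0 <= x < 1 /\ ~ regular_at l.+1 v x] #<= `I_p)%card].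

Definition not_shattering (R : realType) (l : nat) (c : R) (u0 g : R -> R)
    (p : nat) (L c0 T : R) : Prop :=
  forall t, 0 <= t <= T -> piecewise_regular l p L c0 (exact_sol c u0 g t).

Definition local_max (R : realType) (g : R -> R) (x : R) : Prop :=
  \forall y \near x, g y <= g x.

Definition twice_differentiable_at (R : realType) (g : R -> R) (x : R) : Prop :=
  (\forall y \near x, derivable g y 1) /\ derivable (derive1 g) x 1.

(* Periodic version of Delta^2_q(0,1). *)
Definition Delta2 (R : realType) (q : nat) (g : R -> R) : Prop :=
  ([set x | 0 <= x < 1 /\ local_max g x] #<= `I_q)%card /\
  (forall x, local_max g x -> twice_differentiable_at g x).

(* Cells are numbered from 0: cell j is ]x j, x j.+1[ for j < N; the values
   of x beyond N are irrelevant. *)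
Definition is_mesh (R : realType) (N : nat) (x : nat -> R) : Prop :=
  [/\ x 0%N = 0, x N = 1 & forall j, (j < N)%N -> x j < x j.+1].

Definition mesh_size (R : realType) (N : nat) (x : nat -> R) : R :=
  \big[Num.max/0]_(j < N) (x j.+1 - x j).

(* Elements of V_h are L^2 classes: the values of [v] at the (finitely many)
   mesh points are left unspecified, and are never used. *)
Definition in_Vh (R : realType) (k N : nat) (x : nat -> R) (v : R -> R) : Prop :=
  periodic v 1 /\
  forall j, (j < N)%N -> exists2 p : {poly R}, (size p <= k.+1)%N &
    forall y, x j < y < x j.+1 -> v y = p.[y].

Definition is_L2proj (R : realType) (k N : nat) (x : nat -> R)
    (f w : R -> R) : Prop :=
  in_Vh k N x w /\
  forall phi, in_Vh k N x phi ->
    \int[lebesgue_measure]_(y in `]0%R, 1%R[) ((f y - w y) * phi y) = 0.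

Definition L2norm (R : realType) (f : R -> R) : R :=
  Num.sqrt (\int[lebesgue_measure]_(y in `]0%R, 1%R[) (`|f y| ^+ 2)).

(* Rodrigues formula *)
Definition legendre (R : realType) (n : nat) : {poly R} :=
  ((2 ^ n * n`!)%:R)^-1 *: derivn n (('X^2 - 1) ^+ n).

(* [xi] lists the k+1 Gauss-Legendre points of the reference cell ]-1,1[. *)
Definition is_gauss_nodes (R : realType) (k : nat) (xi : 'I_k.+1 -> R) : Prop :=
  (forall a b : 'I_k.+1, (a < b)%N -> xi a < xi b) /\
  (forall a, -1 < xi a < 1 /\ root (legendre R k.+1) (xi a)).

(* Interpolatory weight (integral of the Lagrange basis polynomial), normalised
   by the length 2 of the reference cell; it is the same on every cell. *)
Definition gauss_weight (R : realType) (k : nat) (xi : 'I_k.+1 -> R)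
    (a : 'I_k.+1) : R :=
  2^-1 * \int[lebesgue_measure]_(y in `[-1, 1])
    (\prod_(b < k.+1 | b != a) ((y - xi b) / (xi a - xi b))).

Definition gauss_point (R : realType) (k : nat) (x : nat -> R)
    (xi : 'I_k.+1 -> R) (j : nat) (a : 'I_k.+1) : R :=
  x j + (x j.+1 - x j) * (1 + xi a) / 2.

Definition l2norm (R : realType) (k N : nat) (x : nat -> R)
    (xi : 'I_k.+1 -> R) (f : R -> R) : R :=
  Num.sqrt (\sum_(j < N) \sum_(a < k.+1)
    gauss_weight xi a * `|f (gauss_point x xi j a)| ^+ 2 * (x j.+1 - x j)).

(* [Gv] below is G^{SL}(u_h^n), the projection of u_h^n(. - c dt). *)
Definition is_sldg (R : realType) (k N : nat) (x : nat -> R)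
    (xi : 'I_k.+1 -> R) (c dt : R) (u0 gt : R -> R) (uh : nat -> R -> R) : Prop :=
  is_L2proj k N x u0 (uh 0%N) /\
  forall n, in_Vh k N x (uh n.+1) /\
    exists2 Gv, is_L2proj k N x (fun y => uh n (y - c * dt)) Gv &
      forall j a, (j < N)%N ->
        uh n.+1 (gauss_point x xi j a) =
        Num.max (Gv (gauss_point x xi j a)) (gt (gauss_point x xi j a)).

Definition two_point_max (R : realType) (c dt : R) (g : R -> R) (y : R) : R :=
  Num.max (g y) (g (y - c * dt)).

(* q_{k,l} *)
Definition rate (R : realType) (k l : nat) : R :=
  Num.min ((minn k l).+1%:R) (3 / 2).

(* Main.v *)
(* The exact solution satisfies u(t + dt, y) = max (u(t, y - c dt), g_dt(y)),
   which the scheme mimics at the Gauss points.  On V_h the L2 norm equals the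
   discrete norm, because Gauss quadrature is exact up to degree 2k+1, and the
   maximum and the projection are nonexpansive; hence each step increases the
   error |u_h^n - u^n| by at most two interpolation errors plus |gt - g_dt|, and
   there are at most T / dt steps.

   Interpolation error.  On each cell it is at most twice the sup distance to
   any polynomial of degree <= k.  Constants and the Lipschitz bound M give the
   rate 1.  When k, l >= 1, a stretch of length dl free of singular points has
   |w''| <= C (M / dl + c0) by a Landau-Kolmogorov inequality, so a cell of length
   h_j contributes O(h^3 h_j / dl) to the squared error and the stretch O(h^3);
   so does each of the at most p cells containing a singular point.

   Two-point maximum.  It differs from g_dt only where the maximum is attained
   at an interior local maximum s of g.  There g(s) - g(y) = O((y - s)^2)
   = O(dt^2), and the cells concerned have total length O(dt + h). *)

Require Import Defs.
From mathcomp Require Import all_boot all_order all_algebra.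
From mathcomp Require Import all_classical all_reals all_analysis measurable_realfun.
From mathcomp Require Import ring lra zify.
Set Implicit Arguments.
Unset Strict Implicit.
Unset Printing Implicit Defensive.
Import Order.TTheory GRing.Theory Num.Theory.
Import numFieldNormedType.Exports.
Local Open Scope classical_set_scope.
Local Open Scope ring_scope.

(** * Integrals of bounded measurable functions *)

(** The rate stops at 3/2 because a cell containing a kink is only estimated by the Lipschitz bound:
    its pointwise error is O(h), hence its squared L2 error O(h^3), whatever the degree. Keeping
    that rate elsewhere takes a bound on the second derivative, while the class controls only the
    first derivative and the one of order l + 1. The bound that can be recovered degrades like 1 /
    dl, and singular points may be arbitrarily close to each other. The loss is harmless because
    only stretches made of whole cells are used, so that h_j <= dl: of the two factors 1 / dl in the
    squared error, one is absorbed by h_j / dl <= 1 and the other by summing the h_j over the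
    stretch. Thus neither a ratio of cell sizes nor a distance between singular points enters the
    constant. The exact solution is not in V_h, so its L2 norm and its discrete norm cannot be
    exchanged. Its interpolant at the Gauss points, which the discrete norm does not distinguish
    from it, mediates between the two norms. *)

(** Boundedness on the whole line makes the class stable under products and translations and gives
    integrability on every bounded interval, so linearity of the integral has no further side
    condition. Elements of V_h and periodic Lipschitz functions belong to it; nonconstant
    polynomials do not. *)
Definition bmeas (R : realType) (f : R -> R) : Prop :=
  measurable_fun setT f /\ exists M : R, forall y, `|f y| <= M.

Definition oint (R : realType) (f : R -> R) (a b : R) : R :=
  \int[lebesgue_measure]_(y in `]a, b[) f y.

Section BoundedMeasurable.
Variable R : realType.
Implicit Types (f g : R -> R) (a b c s : R).

Lemma bmeas_cst s : bmeas (fun=> s : R).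
Proof. by split; [exact: measurable_cst|exists `|s|]. Qed.

Lemma bmeasD f g : bmeas f -> bmeas g -> bmeas (fun y => f y + g y).
Proof.
move=> [mf [A fA]] [mg [B gB]]; split; first exact: measurable_funD.
by exists (A + B) => y; rewrite (le_trans (ler_normD _ _))// lerD.
Qed.

Lemma bmeasM f g : bmeas f -> bmeas g -> bmeas (fun y => f y * g y).
Proof.
move=> [mf [A fA]] [mg [B gB]]; split; first exact: measurable_funM.
by exists (A * B) => y; rewrite normrM ler_pM.
Qed.

Lemma bmeasB f g : bmeas f -> bmeas g -> bmeas (fun y => f y - g y).
Proof.
move=> bf bg; have := bmeasD bf (bmeasM (bmeas_cst (-1)) bg).
by congr bmeas; apply/funext => y; rewrite mulN1r.
Qed.

Lemma bmeas_sqr f : bmeas f -> bmeas (fun y => f y ^+ 2).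
Proof.
move=> bf; have := bmeasM bf bf.
by congr bmeas; apply/funext => y; rewrite expr2.
Qed.

Lemma bmeas_comp f (u : R -> R) :
  measurable_fun setT u -> bmeas f -> bmeas (fun y => f (u y)).
Proof.
move=> mu [mf [A fA]]; split; first exact: (measurableT_comp mf mu).
by exists A => y; exact: fA.
Qed.

Lemma measurable_subr s : measurable_fun setT (fun y : R => y - s).
Proof.
apply: continuous_measurable_fun => y.
by apply: cvgB; [exact: cvg_id|exact: cvg_cst].
Qed.

Lemma bmeas_shift f s : bmeas f -> bmeas (fun y => f (y - s)).
Proof. by apply: bmeas_comp => //; exact: measurable_subr. Qed.

Lemma bmeas_integrable f a b (i j : bool) : bmeas f ->
  lebesgue_measure.-integrable [set` Interval (BSide i a) (BSide j b)]
    (EFin \o f).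
Proof.
move=> [mf [A fA]]; apply: measurable_bounded_integrable => //=.
- by rewrite lebesgue_measure_itv/=; case: ifPn => // _; rewrite -EFinB ltry.
- exact: measurable_funTS.
- exists A; split; first exact: num_real.
  by move=> M AM y _ /=; rewrite (le_trans (fA y))// ltW.
Qed.

Lemma oint_bnd f a b (i j : bool) : bmeas f ->
  \int[lebesgue_measure]_(y in [set` Interval (BSide i a) (BSide j b)]) f y =
  oint f a b.
Proof.
move=> [mf _]; rewrite /oint /Rintegral; congr fine.
by apply: integral_itv_bndoo; apply/measurable_EFinP/measurable_funTS.
Qed.

Lemma eq_oint f g a b :
  (forall y, a < y < b -> f y = g y) -> oint f a b = oint g a b.
Proof.
by move=> fg; apply: eq_Rintegral => y; rewrite inE/= in_itv/=; exact: fg.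
Qed.

Lemma ointD f g a b : bmeas f -> bmeas g ->
  oint (fun y => f y + g y) a b = oint f a b + oint g a b.
Proof. by move=> bf bg; apply: RintegralD => //; exact: bmeas_integrable. Qed.

Lemma ointZ f s a b : bmeas f ->
  oint (fun y => s * f y) a b = s * oint f a b.
Proof. by move=> bf; apply: RintegralZl => //; exact: bmeas_integrable. Qed.

Lemma oint_ge0 f a b : (forall y, a < y < b -> 0 <= f y) -> 0 <= oint f a b.
Proof. by move=> f0; apply: Rintegral_ge0 => y/=; rewrite in_itv/=; exact: f0. Qed.

Lemma oint_cst s a b : a <= b -> oint (fun=> s) a b = s * (b - a).
Proof.
move=> ab; rewrite /oint Rintegral_cst//= lebesgue_measure_itv/= lte_fin.
by move: ab; rewrite le_eqVlt => /predU1P[->|->] //=; rewrite ltxx subrr.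
Qed.

Lemma oint_split f a b c : bmeas f -> a <= b -> b <= c ->
  oint f a c = oint f a b + oint f b c.
Proof.
move=> bf ab bc.
rewrite -(oint_bnd a c true true bf) -(oint_bnd a b true true bf).
rewrite -(oint_bnd b c true true bf).
rewrite (@itv_bndbnd_setU _ _ _ (BLeft b)) ?bnd_simp// Rintegral_setU//=.
- by rewrite -itv_bndbnd_setU ?bnd_simp//; exact: bmeas_integrable.
- apply/disj_setPS => y [/=]; rewrite 2!in_itv/= => /andP[_ yx] /andP[].
  by rewrite leNgt yx.
Qed.

Lemma lebesgue_measure_shift s (A : set R) : measurable A ->
  pushforward lebesgue_measure ((fun y => y - s) : R -> measurableTypeR R) A =
  lebesgue_measure A.
Proof.
have ms := measurable_subr s.
move=> mA; apply/esym/lebesgue_measure_unique => //= _ [[a b]] _ <-.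
rewrite /pushforward/=.
have -> : (fun y : R => y - s) @^-1` `]a, b] = `]a + s, b + s]%classic.
  by apply/seteqP; split=> y /=; rewrite !in_itv/= ltrBrDr lerBlDr.
rewrite !lebesgue_measure_itv/= !lte_fin ltrD2r.
by case: ifP => // _; rewrite -!EFinD; congr EFin; ring.
Qed.

(** Lebesgue measure is its own pushforward under a translation; nonnegativity gives the change of
    variables for pushforwards directly. The lemma serves for squares. *)
Lemma oint_shift f s a b : bmeas f -> (forall y, 0 <= f y) ->
  oint (fun y => f (y - s)) a b = oint f (a - s) (b - s).
Proof.
move=> bf f0; rewrite /oint /Rintegral; congr fine.
have ms := measurable_subr s.
have -> : `]a, b[%classic =
    ((fun y => y - s) : R -> measurableTypeR R) @^-1` `]a - s, b - s[.
  by apply/seteqP; split=> y /=; rewrite !in_itv/= !ltrD2r.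
transitivity (\int[pushforward lebesgue_measure
    ((fun y => y - s)%R : R -> measurableTypeR R)]_(y in `](a - s)%R, (b - s)%R[)
    (f y)%:E)%E; last first.
  by apply: eq_measure_integral => //= A mA AS; exact: lebesgue_measure_shift.
rewrite ge0_integral_pushforward//=.
- by apply/measurable_EFinP/measurable_funTS; case: bf.
- by move=> y _; rewrite lee_fin.
Qed.

End BoundedMeasurable.

(** * Periodic functions and the space V_h *)

Definition frac (R : realType) (y : R) : R := y - (Num.floor y)%:~R.

Section Periodic.
Variable R : realType.
Implicit Types (f g : R -> R) (a b c s y : R).

Lemma frac_itv y : 0 <= frac y < 1.
Proof.
rewrite /frac; have := floor_itv y; rewrite intrD => /andP[]; lra.
Qed.

Lemma fracDz y (z : int) : frac (y + z%:~R) = frac y.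
Proof.
rewrite /frac floorDrz ?intr_int// intrKfloor intrD; ring.
Qed.

Lemma frac_id y : 0 <= y < 1 -> frac y = y.
Proof.
move=> y01; have /eqP : Num.floor y == 0 by rewrite floor_eq.
by rewrite /frac => ->; rewrite subr0.
Qed.

Lemma periodicz f : periodic f 1 -> forall y (z : int), f (y + z%:~R) = f y.
Proof.
move=> fT y [n|n]; first by rewrite -(periodicn fT n y).
rewrite NegzE -(periodicn fT n.+1); congr f.
by rewrite mulrNz pmulrn subrK.
Qed.

Lemma periodic_frac f : periodic f 1 -> forall y, f (frac y) = f y.
Proof. by move=> fT y; rewrite /frac -mulrNz periodicz. Qed.

Lemma measurable_frac : measurable_fun setT (@frac R).
Proof.
apply: measurable_funB; first exact: measurable_id.
by apply: nondecreasing_measurable => // a b ab; rewrite ler_int le_floor.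
Qed.

(** An integer translation brings the window to [[r, 1 + r]] with [r] in [0, 1); its part beyond 1
    is then moved back to [[0, r]]. *)
Lemma oint_periodic f s : bmeas f -> (forall y, 0 <= f y) -> periodic f 1 ->
  oint (fun y => f (y - s)) 0 1 = oint f 0 1.
Proof.
move=> bf f0 fT; rewrite oint_shift//.
set z := Num.floor (- s); set r := frac (- s).
have /andP[r0 r1] : 0 <= r < 1 := frac_itv _.
have shiftz a b (m : int) : oint f (a + m%:~R) (b + m%:~R) = oint f a b.
  have := oint_shift (- m%:~R) a b bf f0; rewrite !opprK => <-.
  by apply: eq_oint => y _; rewrite periodicz.
have -> : 0 - s = r + z%:~R by rewrite /r /frac subrK sub0r.
have -> : 1 - s = (1 + r) + z%:~R by rewrite /r /frac; ring.
rewrite shiftz (@oint_split _ f r 1)// ?(ltW r1) ?lerDl//.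
have := shiftz 0 r 1; rewrite add0r [X in oint f X _ = _](_ : _ = 1)//.
rewrite [X in oint f _ X = _](_ : _ = 1 + r) 1?addrC// => ->.
by rewrite addrC -oint_split// ltW.
Qed.

End Periodic.

Section Mesh.
Variables (R : realType) (N : nat) (x : nat -> R).
Hypothesis mx : is_mesh N x.

Lemma mesh_le i j : (i <= j <= N)%N -> x i <= x j.
Proof.
case: mx => _ _ xS /andP[+ jN]; elim: j jN => [_|j IH jN].
  by rewrite leqn0 => /eqP ->.
rewrite leq_eqVlt => /predU1P[->//|]; rewrite ltnS => /(IH (ltnW jN)) xij.
by rewrite (le_trans xij)// ltW// xS.
Qed.

Lemma mesh_ge0 j : (j <= N)%N -> 0 <= x j.
Proof. by case: mx => <- _ _ jN; apply: mesh_le. Qed.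

Lemma mesh_le1 j : (j <= N)%N -> x j <= 1.
Proof. by case: mx => _ <- _ jN; apply: mesh_le; rewrite jN/=. Qed.

Lemma mesh_cell y : 0 <= y < 1 ->
  exists2 j, (j < N)%N & x j <= y < x j.+1.
Proof.
case: mx => x0 xN xS /andP[y0 y1].
suff : forall n, (n <= N)%N -> y < x n ->
    exists2 j, (j < n)%N & x j <= y < x j.+1.
  by move=> /(_ N (leqnn _)); rewrite xN => /(_ y1).
elim=> [_|n IH nN yn]; first by rewrite x0 ltNge y0.
have [yxn|xny] := ltP y (x n); last by exists n; rewrite ?xny.
have [j jn jy] := IH (ltnW nN) yxn.
by exists j => //; rewrite ltnS ltnW.
Qed.

Lemma le_mesh_size j : (j < N)%N -> x j.+1 - x j <= mesh_size N x.
Proof.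
move=> jN; rewrite /mesh_size.
exact: (le_bigmax _ (fun i : 'I_N => x i.+1 - x i) (Ordinal jN)).
Qed.

Lemma mesh_size_gt0 : 0 < mesh_size N x.
Proof.
case: mx => x0 xN xS; case: N xN xS le_mesh_size => [|n] xN xS lm.
  by move: xN; rewrite x0 => /eqP; rewrite eq_sym oner_eq0.
by rewrite (lt_le_trans _ (lm 0%N _))// subr_gt0 xS.
Qed.

Lemma mesh_lengths (a b : nat) : (a <= b <= N)%N ->
  \sum_(a <= j < b) (x j.+1 - x j) = x b - x a.
Proof. by move=> /andP[ab _]; rewrite telescope_sumr. Qed.

Lemma oint_mesh f : bmeas f ->
  oint f 0 1 = \sum_(0 <= j < N) oint f (x j) (x j.+1).
Proof.
case: mx => x0 xN xS bf.
suff H n : (n <= N)%N ->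
    oint f (x 0%N) (x n) = \sum_(0 <= j < n) oint f (x j) (x j.+1).
  by rewrite -H// x0 xN.
elim: n => [_|n IH nN].
  by rewrite big_nil /oint set_itv_ge ?bnd_simp// Rintegral_set0.
rewrite big_nat_recr//= -IH ?(ltnW nN)// -oint_split//; apply: mesh_le.
  by rewrite /= ltnW.
by rewrite leqnSn.
Qed.

Lemma norm_horner_le (p : {poly R}) y : 0 <= y <= 1 ->
  `|p.[y]| <= \sum_(i < size p) `|p`_i|.
Proof.
move=> /andP[y0 y1]; rewrite horner_coef (le_trans (ler_norm_sum _ _ _))//.
apply: ler_sum => i _; rewrite normrM ler_piMr// ger0_norm ?exprn_ge0//.
exact: exprn_ile1.
Qed.

(** Cells are added one at a time, each mesh point as a singleton since the value there is
    arbitrary. Composition with [frac] then extends the result from [0, 1) to the line. *)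
Lemma in_Vh_bmeas k v : in_Vh k N x v -> bmeas v.
Proof.
move=> [vT vp]; case: mx => x0 xN xS.
have H n : (n <= N)%N ->
    measurable_fun `[0, x n[ v /\ exists M, forall y, 0 <= y < x n -> `|v y| <= M.
  elim: n => [_|n IH nN].
    rewrite x0 set_itv_ge ?bnd_simp//; split; first exact: measurable_fun_set0.
    by exists 0 => y /andP[y0]; rewrite ltNge y0.
  have [mv [M vM]] := IH (ltnW nN).
  have [p _ vpn] := vp _ nN.
  have xn0 : 0 <= x n by apply: mesh_ge0; exact: ltnW.
  have xn1 : x n.+1 <= 1 by apply: mesh_le1.
  split.
    rewrite (@itv_bndbnd_setU _ _ _ (BLeft (x n))) ?bnd_simp ?(ltW (xS _ nN))//.
    rewrite (@itv_bndbnd_setU _ _ (BLeft (x n)) (BRight (x n))) ?bnd_simp ?(xS _ nN)//.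
    apply/measurable_funU => //; first exact: measurableU.
    split=> //; apply/measurable_funU => //; split.
      by rewrite set_itv1; exact: measurable_fun_set1.
    apply: (@eq_measurable_fun _ _ _ _ _ (horner p)); last exact: measurable_poly.
    by move=> y; rewrite inE/= in_itv/= => yn; rewrite vpn.
  exists (Num.max M (Num.max `|v (x n)| (\sum_(i < size p) `|p`_i|))) => y.
  move=> /andP[y0 yn]; rewrite !le_max.
  case: (ltgtP y (x n)) => [yxn|yxn|->]; last by rewrite lexx orbT.
    by rewrite vM// y0.
  by rewrite vpn ?yxn// norm_horner_le ?orbT// y0 ltW// (lt_le_trans yn).
have [] := H N (leqnn _); rewrite xN => mv [M vM].
split; last by exists M => y; rewrite -(periodic_frac vT) vM// frac_itv.
rewrite (_ : v = v \o @frac R); last by apply/funext => y/=; rewrite periodic_frac.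
apply: (@measurable_comp _ _ _ R R R `[0%R, 1%R[%classic v setT (@frac R)) => //.
- by move=> _ [y _ <-]; rewrite /= in_itv/= frac_itv.
- exact: measurable_frac.
Qed.

Lemma in_VhB k v w : in_Vh k N x v -> in_Vh k N x w ->
  in_Vh k N x (fun y => v y - w y).
Proof.
move=> [vT vp] [wT wp]; split=> [y|j jN]; first by rewrite vT wT.
have [p sp vpj] := vp j jN; have [q sq wqj] := wp j jN.
exists (p - q); last by move=> y yj; rewrite hornerD hornerN vpj// wqj.
by rewrite (leq_trans (size_polyD _ _))// size_polyN geq_max sp.
Qed.

End Mesh.

Lemma klipschitzP (R : realType) (f : R -> R) :
  lipschitz f -> exists2 M : R, 0 < M & forall y z, `|f y - f z| <= M * `|y - z|.
Proof.
move=> /pinfty_ex_gt0[M M0 fM]; exists M => // y z.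
exact: (fM (y, z)).
Qed.

Section LipschitzPeriodic.
Variables (R : realType) (f : R -> R) (M : R).
Hypothesis fM : forall y z, `|f y - f z| <= M * `|y - z|.

Lemma klipschitz_continuous : continuous f.
Proof.
move=> y; apply/cvgrPdist_le => e e0.
have M0 : 0 <= M by have := fM 1 0; rewrite subr0 normr1 mulr1; exact: le_trans.
near=> z; rewrite (le_trans (fM _ _))//.
rewrite (@le_trans _ _ ((M + 1) * `|y - z|))// ?ler_wpM2r// ?lerDl//.
rewrite -ler_pdivlMl ?ltr_wpDl//.
near: z; apply: (@cvgr_dist_le _ _ _ _ _ id y) => //.
by rewrite mulr_gt0// invr_gt0 ltr_wpDl.
Unshelve. all: by end_near. Qed.

Lemma klipschitz_bmeas : periodic f 1 -> bmeas f.
Proof.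
move=> fT; split.
  by apply: continuous_measurable_fun; exact: klipschitz_continuous.
exists (`|f 0| + M) => y; rewrite -(periodic_frac fT).
have /andP[y0 y1] := frac_itv y.
have M0 : 0 <= M by have := fM 1 0; rewrite subr0 normr1 mulr1; exact: le_trans.
rewrite -[f (frac y)](subrK (f 0)) addrC (le_trans (ler_normD _ _))// lerD2l.
by rewrite (le_trans (fM _ _))// subr0 ger0_norm// ler_piMr// ltW.
Qed.

End LipschitzPeriodic.

(** * Gauss quadrature *)

Section PolynomialIntegral.
Variable R : realType.
Implicit Types (p q s : {poly R}) (a b : R).

(** The coefficient of degree 0 is a division by zero, that is 0. *)
Definition primitive p : {poly R} := \poly_(i < (size p).+1) (p`_i.-1 / i%:R).

Lemma deriv_primitive p : (primitive p)^`() = p.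
Proof.
apply/polyP => i; rewrite coef_deriv coef_poly ltnS /=.
case: ltnP => [_|/(nth_default 0) ->]; last by rewrite mul0rn.
by rewrite -[LHS]mulr_natr divfK// pnatr_eq0.
Qed.

Lemma oint_hornerE p a b :
  \int[lebesgue_measure]_(y in `[a, b]) p.[y] = oint (horner p) a b.
Proof.
rewrite /oint /Rintegral; congr fine; apply: integral_itv_bndoo.
by apply/measurable_EFinP; exact: measurable_poly.
Qed.

Lemma oint_deriv p a b : a < b -> oint (horner p^`()) a b = p.[b] - p.[a].
Proof.
move=> ab; rewrite -oint_hornerE /Rintegral (@continuous_FTC2 _ _ (horner p))//.
- by apply: continuous_subspaceT; exact: continuous_horner.
- split=> [y _||]; first exact: derivable_horner.
  + by apply: cvg_at_right_filter; exact: continuous_horner.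
  + by apply: cvg_at_left_filter; exact: continuous_horner.
- by move=> y _; rewrite derivE.
Qed.

Lemma oint_horner p a b : a < b ->
  oint (horner p) a b = (primitive p).[b] - (primitive p).[a].
Proof. by move=> ab; rewrite -oint_deriv// deriv_primitive. Qed.

(** Polynomials escape [bmeas], so linearity is obtained from primitives and the fundamental theorem
    of calculus. *)
Lemma oint_hornerD p q a b : a < b ->
  oint (horner (p + q)) a b = oint (horner p) a b + oint (horner q) a b.
Proof.
move=> ab; have -> : p + q = (primitive p + primitive q)^`().
  by rewrite derivD !deriv_primitive.
rewrite oint_deriv// !oint_horner// !hornerD; ring.
Qed.

Lemma oint_hornerZ c p a b : a < b ->
  oint (horner (c *: p)) a b = c * oint (horner p) a b.
Proof.
move=> ab; have -> : c *: p = (c *: primitive p)^`().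
  by rewrite derivZ deriv_primitive.
rewrite oint_deriv// oint_horner// !hornerZ; ring.
Qed.

Lemma oint_horner_sum n (F : 'I_n -> {poly R}) a b : a < b ->
  oint (horner (\sum_(i < n) F i)) a b = \sum_(i < n) oint (horner (F i)) a b.
Proof.
move=> ab; elim: n F => [|n IH] F.
  by rewrite !big_ord0 -[0](@deriv0 R) oint_deriv// !horner0 subrr.
by rewrite !big_ord_recl oint_hornerD// IH.
Qed.

Definition cell_map a b : {poly R} :=
  ((b - a) / 2) *: 'X + (a + (b - a) / 2)%:P.

Lemma horner_cell_map a b y :
  (cell_map a b).[y] = a + (b - a) * (1 + y) / 2.
Proof. rewrite /cell_map !hornerE/=; lra. Qed.

Lemma size_cell_map a b : a < b -> size (cell_map a b) = 2%N.
Proof.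
move=> ab; rewrite /cell_map size_polyDl size_scale ?size_polyX//.
- by apply: lt0r_neq0; rewrite divr_gt0// subr_gt0.
- by rewrite (leq_ltn_trans (size_polyC_leq1 _)).
- by apply: lt0r_neq0; rewrite divr_gt0// subr_gt0.
Qed.

(** Affine change of variables from the reference cell: composing a primitive of [p] with [cell_map]
    gives a primitive of the right-hand integrand. *)
Lemma oint_cell_map p a b : a < b ->
  oint (horner p) a b =
  (b - a) / 2 * oint (horner (p \Po cell_map a b)) (-1) 1.
Proof.
move=> ab; have N11 : -1 < 1 :> R by lra.
rewrite -oint_hornerZ//.
have -> : ((b - a) / 2) *: (p \Po cell_map a b) =
    (primitive p \Po cell_map a b)^`().
  rewrite deriv_comp deriv_primitive /cell_map derivD derivZ derivX derivC.
  by rewrite addr0 alg_polyC [RHS]mulrC mul_polyC.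
rewrite oint_deriv// oint_horner// !horner_comp !horner_cell_map.
by congr (_.[_] - _.[_]); lra.
Qed.

(** Each derivative lowers the multiplicity of the root [a] by at most one; the cofactor [S] is
    general because it changes at every step. *)
Lemma derivn_root (W S : {poly R}) a n m :
  W = S * ('X - a%:P) ^+ n -> (m < n)%N -> (W^`(m)).[a] = 0.
Proof.
elim: m n W S => [|m IH] [|n] W S WE // mn.
  by rewrite derivn0 WE hornerM horner_exp !hornerE subrr expr0n/= mulr0.
rewrite derivSn.
apply: (IH n _ (S^`() * ('X - a%:P) + S *+ n.+1)) => //.
rewrite WE derivM deriv_exp derivXsubC mul1r exprS/= mulrA mulrDl.
by congr (_ + _); rewrite mulrnAr mulrnAl.
Qed.

Definition rodrigues n : {poly R} := ('X^2 - 1) ^+ n.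

Lemma rodriguesE n :
  rodrigues n = ('X + 1%:P) ^+ n * ('X - 1%:P) ^+ n.
Proof. by rewrite /rodrigues -exprMn_comm; [congr (_ ^+ _); ring|exact: mulrC]. Qed.

Lemma rodrigues_ends n m : (m < n)%N ->
  ((rodrigues n)^`(m)).[1] = 0 /\ ((rodrigues n)^`(m)).[-1] = 0.
Proof.
move=> mn; split; apply: derivn_root mn; first exact: rodriguesE.
rewrite rodriguesE mulrC; congr (_ * _ ^+ _).
by rewrite polyCN opprK.
Qed.

(* Integrate by parts [m] times: the derivatives of (X^2 - 1)^n of order < n
   vanish at both endpoints. *)
Lemma legendre_orthogonal n m s : (m <= n)%N -> (size s <= m)%N ->
  oint (horner ((rodrigues n)^`(m) * s)) (-1) 1 = 0.
Proof.
have N11 : -1 < 1 :> R by lra.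
elim: m s => [|m IH] s mn.
  rewrite leqn0 size_poly_eq0 => /eqP ->.
  by rewrite mulr0 -[0](@deriv0 R) oint_deriv// !horner0 subrr.
move=> sm.
have -> : (rodrigues n)^`(m.+1) * s =
    ((rodrigues n)^`(m) * s)^`() + (-1) *: ((rodrigues n)^`(m) * s^`()).
  by rewrite derivM -derivnS scaleN1r addrK.
have [H1 HN1] := rodrigues_ends mn.
rewrite oint_hornerD// oint_hornerZ// IH ?(ltnW mn)//; last first.
  have [->|s0] := eqVneq s 0; first by rewrite deriv0 size_poly0.
  by rewrite -ltnS (leq_trans _ sm)// lt_size_deriv.
by rewrite oint_deriv// !hornerM H1 HN1 !mul0r; ring.
Qed.

Lemma size_rodrigues n : size (rodrigues n) = n.*2.+1.
Proof.
have W0 : rodrigues n != 0.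
  by rewrite /rodrigues expf_neq0// -size_poly_eq0 size_XnsubC.
rewrite -(prednK (_ : (0 < size (rodrigues n))%N)) ?size_poly_gt0//.
by rewrite /rodrigues size_exp size_XnsubC//= mul2n.
Qed.

Lemma size_derivn_rodrigues n : size ((rodrigues n)^`(n)) = n.+1.
Proof.
have cz i : (n < i)%N -> ((rodrigues n)^`(n))`_i = 0.
  move=> ni; rewrite coef_derivn nth_default ?mul0rn// size_rodrigues.
  by rewrite -addnn ltn_add2l.
have cn : ((rodrigues n)^`(n))`_n != 0.
  rewrite coef_derivn -mulr_natr mulf_neq0//; last first.
    by rewrite pnatr_eq0 -lt0n ffact_gt0 leq_addr.
  have := lead_coef_eq0 (rodrigues n).
  rewrite lead_coefE size_rodrigues -addnn /= -size_poly_eq0 size_rodrigues.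
  by move=> ->.
apply/eqP; rewrite eqn_leq; apply/andP; split.
  by apply/leq_sizeP => i; exact: cz.
by rewrite ltnNge; apply: contra cn => /leq_sizeP ->.
Qed.

End PolynomialIntegral.

Section Lagrange.
Variables (R : realType) (k : nat) (z : 'I_k.+1 -> R).
Hypothesis zI : injective z.

Definition lagrange (a : 'I_k.+1) : {poly R} :=
  \prod_(b < k.+1 | b != a) ((z a - z b)^-1 *: ('X - (z b)%:P)).

Definition interpolant (f : R -> R) : {poly R} :=
  \sum_(a < k.+1) f (z a) *: lagrange a.

Lemma horner_lagrangeE a y :
  (lagrange a).[y] = \prod_(b < k.+1 | b != a) ((y - z b) / (z a - z b)).
Proof.
rewrite horner_prod; apply: eq_bigr => b _.
by rewrite hornerZ hornerXsubC mulrC.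
Qed.

Lemma lagrange_node a b : (lagrange a).[z b] = (a == b)%:R.
Proof.
rewrite horner_lagrangeE; have [<-|ab] := eqVneq a b.
  rewrite big1// => c ca; rewrite divff// subr_eq0.
  by rewrite (inj_eq zI) eq_sym.
by rewrite (bigD1 b) 1?eq_sym//= subrr !mul0r.
Qed.

Lemma size_lagrange a : (size (lagrange a) <= k.+1)%N.
Proof.
apply: (leq_trans (size_prod_leq _ _)); rewrite leq_subLR.
have card_k : #|[pred b : 'I_k.+1 | b != a]| = k.
  by have := cardC1 a; rewrite card_ord.
rewrite (leq_trans (_ : _ <= (\sum_(b < k.+1 | b != a) 2).+1)%N)//.
  rewrite ltnS; apply: leq_sum => b _.
  by rewrite (leq_trans (size_scale_leq _ _))// size_XsubC.
by rewrite sum_nat_const card_k muln2 -addnn addnS.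
Qed.

Lemma interpolant_node f b : (interpolant f).[z b] = f (z b).
Proof.
rewrite /interpolant horner_sum (bigD1 b)//= hornerZ lagrange_node eqxx mulr1.
by rewrite big1 ?addr0// => a /negPf ab; rewrite hornerZ lagrange_node ab mulr0.
Qed.

Lemma size_interpolant f : (size (interpolant f) <= k.+1)%N.
Proof.
apply: (leq_trans (size_sum _ _ _)); apply/bigmax_leqP => a _.
by rewrite (leq_trans (size_scale_leq _ _))// size_lagrange.
Qed.

End Lagrange.

Section GaussQuadrature.
Variables (R : realType) (k : nat) (xi : 'I_k.+1 -> R).
Hypothesis gxi : is_gauss_nodes xi.
Implicit Types (p q : {poly R}) (a b : 'I_k.+1).
Let N11 : -1 < 1 :> R. Proof. lra. Qed.

Lemma gauss_nodes_inj : injective xi.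
Proof.
case: gxi => lt_xi _ a b ab; apply/val_inj; case: (ltngtP a b) => // /lt_xi;
by rewrite ab ltxx.
Qed.

Lemma gauss_weightE a :
  gauss_weight xi a = 2^-1 * oint (horner (lagrange xi a)) (-1) 1.
Proof.
rewrite -oint_hornerE /gauss_weight; congr (_ * _).
by apply: eq_Rintegral => y _; rewrite horner_lagrangeE.
Qed.

(** The nodes are k + 1 distinct roots of a polynomial of degree exactly k + 1, which is therefore a
    nonzero multiple of the product of the ['X - (xi a)%:P]; that product divides [q]. *)
Lemma vanishing_at_gauss_nodes q : (forall a, q.[xi a] = 0) ->
  exists r, q = r * (rodrigues R k.+1)^`(k.+1).
Proof.
move=> q0; pose rs := [seq xi a | a <- enum 'I_k.+1].
have urs : uniq rs by rewrite map_inj_uniq ?enum_uniq//; exact: gauss_nodes_inj.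
have [|r ->] := @uniq_roots_prod_XsubC _ q rs _ (etrans (uniq_rootsE rs) urs).
  by apply/allP => _ /mapP[a _ ->]; apply/rootP.
set D := _^`(_).
have DE : D = lead_coef D *: \prod_(y <- rs) ('X - y%:P).
  apply: all_roots_prod_XsubC.
  - by rewrite /D size_derivn_rodrigues size_map size_enum_ord.
  - apply/allP => _ /mapP[a _ ->]; case: gxi => _ /(_ a)[_].
    by rewrite /legendre rootZ// invr_eq0 pnatr_eq0 muln_eq0 expn_eq0/= -lt0n fact_gt0.
  - by rewrite uniq_rootsE.
have D0 : lead_coef D != 0.
  by rewrite lead_coef_eq0 -size_poly_eq0 size_derivn_rodrigues.
exists ((lead_coef D)^-1 *: r); rewrite {2}DE -scalerAl -scalerAr scalerA.
by rewrite mulVf// scale1r.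
Qed.

(** The difference between [q] and its interpolant vanishes at the nodes, so it is the Rodrigues
    derivative times a factor of degree at most k, to which that derivative is orthogonal. The
    interpolant itself is integrated exactly by definition of the weights. *)
Lemma gauss_exact q : (size q <= k.+1.*2)%N ->
  oint (horner q) (-1) 1 = 2 * \sum_(a < k.+1) gauss_weight xi a * q.[xi a].
Proof.
move=> sq; pose P := interpolant xi (horner q).
have [|r qPE] := @vanishing_at_gauss_nodes (q - P).
  move=> a; rewrite hornerD hornerN interpolant_node ?subrr//.
  exact: gauss_nodes_inj.
have sr : (size r <= k.+1)%N.
  have [->|r0] := eqVneq r 0; first by rewrite size_poly0.
  have D0 : (rodrigues R k.+1)^`(k.+1) != 0.
    by rewrite -size_poly_eq0 size_derivn_rodrigues.
  have : (size (q - P)%R <= k.+1.*2)%N.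
    rewrite (leq_trans (size_polyD _ _))// size_polyN geq_max sq.
    by rewrite (leq_trans (size_interpolant _ _))// -addnn leq_addl.
  rewrite qPE size_mul// size_derivn_rodrigues addnS/= -addnn.
  by rewrite leq_add2r.
have := legendre_orthogonal (leqnn k.+1) sr; rewrite mulrC -qPE => qP0.
rewrite -[q](subrK P) oint_hornerD// qP0 add0r /P /interpolant oint_horner_sum//.
rewrite mulr_sumr; apply: eq_bigr => a _; rewrite oint_hornerZ// gauss_weightE.
have -> : (q - P + P).[xi a] = q.[xi a] by rewrite subrK.
by rewrite mulrA mulrA mulfV ?mul1r 1?mulrC// pnatr_eq0.
Qed.

(** The rule is exact on the square of a Lagrange polynomial, of degree at most 2k, and there it
    reduces to twice the single weight. *)
Lemma gauss_weight_ge0 a : 0 <= gauss_weight xi a.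
Proof.
have szl := size_lagrange xi a.
have := @gauss_exact (lagrange xi a ^+ 2); rewrite (bigD1 a)//=.
rewrite horner_exp lagrange_node ?eqxx ?expr1n ?mulr1; last exact: gauss_nodes_inj.
rewrite big1 ?addr0; last first.
  move=> b /negPf ba; rewrite horner_exp lagrange_node; last exact: gauss_nodes_inj.
  by rewrite eq_sym ba expr0n mulr0.
rewrite -(@pmulr_rge0 _ 2)// => <-.
  by apply: oint_ge0 => y _; rewrite horner_exp sqr_ge0.
rewrite expr2 (leq_trans (size_polyMleq _ _))// -addnn.
by rewrite (leq_trans (leq_pred _))// leq_add.
Qed.

Lemma sum_gauss_weight : \sum_(a < k.+1) gauss_weight xi a = 1.
Proof.
have := @gauss_exact 1; rewrite size_poly1 => /(_ _)/(congr1 (fun s => 2^-1 * s)).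
rewrite mulrA mulVf ?pnatr_eq0// mul1r => H.
under eq_bigr => a _ do rewrite -[gauss_weight _ _]mulr1 -(hornerC 1 (xi a)).
rewrite -H//.
by rewrite -derivX oint_deriv// !hornerX; lra.
Qed.

Lemma gauss_cell q (x : nat -> R) j : x j < x j.+1 -> (size q <= k.+1.*2)%N ->
  oint (horner q) (x j) (x j.+1) =
  \sum_(a < k.+1)
     gauss_weight xi a * q.[gauss_point x xi j a] * (x j.+1 - x j).
Proof.
move=> xj sq; rewrite oint_cell_map// gauss_exact; last first.
  by rewrite size_comp_poly2// size_cell_map.
rewrite !mulr_sumr; apply: eq_bigr => a _.
rewrite horner_comp horner_cell_map -/(gauss_point _ _ _ _).
by field.
Qed.

Lemma gauss_point_in (x : nat -> R) j a : x j < x j.+1 ->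
  x j < gauss_point x xi j a < x j.+1.
Proof.
case: gxi => _ /(_ a)[/andP[l r] _] xj; rewrite /gauss_point.
have h0 : 0 < x j.+1 - x j by rewrite subr_gt0.
have : 0 < (x j.+1 - x j) * (1 + xi a) by rewrite mulr_gt0//; lra.
have : 0 < (x j.+1 - x j) * (1 - xi a) by rewrite mulr_gt0//; lra.
lra.
Qed.

Lemma gauss_point_inj (x : nat -> R) j : x j < x j.+1 ->
  injective (gauss_point x xi j).
Proof.
move=> xj a b; rewrite /gauss_point => ab; apply: gauss_nodes_inj.
have h0 : x j.+1 - x j != 0 by rewrite gt_eqF// subr_gt0.
apply: (mulfI h0); lra.
Qed.

End GaussQuadrature.

(** * One step of the scheme *)

(* Cauchy-Schwarz, by evaluating the form at s = sqrt c, t = - sqrt a. *)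
Lemma sqrt_psd_triangle (R : realType) (a b c : R) :
  0 <= a -> 0 <= c -> (forall s t, 0 <= s ^+ 2 * a + 2 * (s * t * b) + t ^+ 2 * c) ->
  Num.sqrt (a + 2 * b + c) <= Num.sqrt a + Num.sqrt c.
Proof.
move=> a0 c0 psd.
suff bac : b <= Num.sqrt a * Num.sqrt c.
  rewrite -[leRHS]ger0_norm ?addr_ge0 ?sqrtr_ge0// -sqrtr_sqr ler_sqrt ?sqr_ge0//.
  by rewrite sqrrD !sqr_sqrtr//; move: bac; lra.
have [a_eq0|a_neq0] := eqVneq a 0.
  rewrite a_eq0 sqrtr0 mul0r leNgt; apply/negP => b0.
  (* For [a = 0] and [t = 1] the form is affine in [s]; this [s] gives it the value - c - 2, which
     is negative. The case [c = 0] is symmetric. *)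
  have := psd (- (c + 1) / b) 1; rewrite a_eq0.
  have -> : - (c + 1) / b * 1 * b = - (c + 1) by field; rewrite gt_eqF.
  lra.
have [c_eq0|c_neq0] := eqVneq c 0.
  rewrite c_eq0 sqrtr0 mulr0 leNgt; apply/negP => b0.
  have := psd 1 (- (a + 1) / b); rewrite c_eq0.
  have -> : 1 * (- (a + 1) / b) * b = - (a + 1) by field; rewrite gt_eqF.
  lra.
have a_gt0 : 0 < Num.sqrt a by rewrite sqrtr_gt0 lt_def a_neq0.
have c_gt0 : 0 < Num.sqrt c by rewrite sqrtr_gt0 lt_def c_neq0.
have := psd (Num.sqrt c) (- Num.sqrt a).
rewrite sqrrN !sqr_sqrtr// => H.
have ac_gt0 : 0 < Num.sqrt a * Num.sqrt c by rewrite mulr_gt0.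
rewrite -(ler_pM2l ac_gt0).
have -> : Num.sqrt a * Num.sqrt c * (Num.sqrt a * Num.sqrt c) = a * c.
  by rewrite mulrACA -!expr2 !sqr_sqrtr.
lra.
Qed.

Section L2norm.
Variable R : realType.
Implicit Types f g h : R -> R.

Lemma L2normE f : L2norm f = Num.sqrt (oint (fun y => f y ^+ 2) 0 1).
Proof.
rewrite /L2norm; congr Num.sqrt; apply: eq_Rintegral => y _.
by rewrite real_normK ?num_real.
Qed.

Lemma L2norm_ge0 f : 0 <= L2norm f.
Proof. exact: sqrtr_ge0. Qed.

Lemma L2norm_sqr f : L2norm f ^+ 2 = oint (fun y => f y ^+ 2) 0 1.
Proof. by rewrite L2normE sqr_sqrtr// oint_ge0// => y _; rewrite sqr_ge0. Qed.

Lemma ler_L2normD f g : bmeas f -> bmeas g ->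
  L2norm (fun y => f y + g y) <= L2norm f + L2norm g.
Proof.
move=> bf bg; rewrite !L2normE.
have bff := bmeas_sqr bf; have bgg := bmeas_sqr bg; have bfg := bmeasM bf bg.
have E s t : oint (fun y => (s * f y + t * g y) ^+ 2) 0 1 =
    s ^+ 2 * oint (fun y => f y ^+ 2) 0 1 +
    2 * (s * t * oint (fun y => f y * g y) 0 1) +
    t ^+ 2 * oint (fun y => g y ^+ 2) 0 1.
  have bZ u v := bmeasM (bmeas_cst u) v.
  rewrite mulrA -!ointZ// -!ointD//; do ?[exact: bZ|apply: bmeasD].
  by apply: eq_oint => y _; ring.
have -> : oint (fun y => (f y + g y) ^+ 2) 0 1 =
    oint (fun y => f y ^+ 2) 0 1 + 2 * oint (fun y => f y * g y) 0 1 +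
    oint (fun y => g y ^+ 2) 0 1.
  have := E 1 1; rewrite !expr1n !mul1r => <-.
  by apply: eq_oint => y _; rewrite !mul1r.
apply: sqrt_psd_triangle; [by apply: oint_ge0 => y _; exact: sqr_ge0..|].
by move=> s t; rewrite -E; apply: oint_ge0 => y _; exact: sqr_ge0.
Qed.

Lemma ler_L2normB g f h : bmeas f -> bmeas g -> bmeas h ->
  L2norm (fun y => f y - h y) <=
  L2norm (fun y => f y - g y) + L2norm (fun y => g y - h y).
Proof.
move=> bf bg bh.
have := ler_L2normD (bmeasB bf bg) (bmeasB bg bh).
by under [X in L2norm X <= _]funext => y do rewrite subrKA.
Qed.

Lemma L2norm_distC f g :
  L2norm (fun y => f y - g y) = L2norm (fun y => g y - f y).
Proof.
by rewrite !L2normE; congr Num.sqrt; apply: eq_oint => y _; rewrite -sqrrN opprB.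
Qed.

Lemma L2norm_shift f s : bmeas f -> periodic f 1 ->
  L2norm (fun y => f (y - s)) = L2norm f.
Proof.
move=> bf fT; rewrite !L2normE; congr Num.sqrt.
apply: (@oint_periodic R (fun y => f y ^+ 2)).
- exact: bmeas_sqr.
- by move=> y; exact: sqr_ge0.
- by move=> y; rewrite fT.
Qed.

End L2norm.

(** * Discrete norm, L2 projection, and the error of one step *)

Section Discrete.
Variables (R : realType) (k N : nat) (x : nat -> R) (xi : 'I_k.+1 -> R).
Hypotheses (mx : is_mesh N x) (gxi : is_gauss_nodes xi).
Implicit Types f g h v w : R -> R.
Local Notation gp := (gauss_point x xi).
Local Notation l2 := (l2norm N x xi).

Let x_lt (j : 'I_N) : x j < x j.+1.
Proof. by case: mx => _ _; apply. Qed.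

Lemma gauss_weight_cell_ge0 (j : 'I_N) (a : 'I_k.+1) :
  0 <= gauss_weight xi a * (x j.+1 - x j).
Proof. by rewrite mulr_ge0 ?gauss_weight_ge0// subr_ge0 ltW. Qed.

Lemma l2normE f :
  l2 f = Num.sqrt (\sum_(j < N) \sum_(a < k.+1)
    gauss_weight xi a * (x j.+1 - x j) * f (gp j a) ^+ 2).
Proof.
rewrite /l2norm; congr Num.sqrt; apply: eq_bigr => j _; apply: eq_bigr => a _.
by rewrite real_normK ?num_real// mulrAC.
Qed.

Lemma l2norm_le f g :
  (forall (j : 'I_N) a, `|f (gp j a)| <= `|g (gp j a)|) -> l2 f <= l2 g.
Proof.
move=> fg; rewrite !l2normE ler_wsqrtr//.
apply: ler_sum => j _; apply: ler_sum => a _.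
rewrite ler_wpM2l ?gauss_weight_cell_ge0//.
by rewrite -[leLHS]real_normK ?num_real// -[leRHS]real_normK ?num_real// ler_pXn2r ?nnegrE.
Qed.

Lemma ler_l2normD f g : l2 (fun y => f y + g y) <= l2 f + l2 g.
Proof.
rewrite !l2normE.
pose W f g := \sum_(j < N) \sum_(a < k.+1)
  gauss_weight xi a * (x j.+1 - x j) * (f (gp j a) * g (gp j a)).
have E s t : \sum_(j < N) \sum_(a < k.+1)
    gauss_weight xi a * (x j.+1 - x j) * (s * f (gp j a) + t * g (gp j a)) ^+ 2 =
    s ^+ 2 * W f f + 2 * (s * t * W f g) + t ^+ 2 * W g g.
  rewrite mulrA /W !mulr_sumr -!big_split/=; apply: eq_bigr => j _.
  rewrite !mulr_sumr -!big_split/=; apply: eq_bigr => a _; ring.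
have := @sqrt_psd_triangle R (W f f) (W f g) (W g g).
have -> : W f f + 2 * W f g + W g g = \sum_(j < N) \sum_(a < k.+1)
    gauss_weight xi a * (x j.+1 - x j) * (f (gp j a) + g (gp j a)) ^+ 2.
  have := E 1 1; rewrite !expr1n !mul1r => <-.
  by apply: eq_bigr => j _; apply: eq_bigr => a _; rewrite !mul1r.
rewrite /W; apply.
- apply: sumr_ge0 => j _; apply: sumr_ge0 => a _.
  by rewrite mulr_ge0 ?gauss_weight_cell_ge0// -expr2 sqr_ge0.
- apply: sumr_ge0 => j _; apply: sumr_ge0 => a _.
  by rewrite mulr_ge0 ?gauss_weight_cell_ge0// -expr2 sqr_ge0.
- move=> s t; rewrite -E; apply: sumr_ge0 => j _; apply: sumr_ge0 => a _.
  by rewrite mulr_ge0 ?gauss_weight_cell_ge0// sqr_ge0.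
Qed.

Lemma L2norm_Vh v : in_Vh k N x v -> L2norm v = l2 v.
Proof.
move=> vV; rewrite L2normE l2normE; congr Num.sqrt.
rewrite (oint_mesh mx); last exact/bmeas_sqr/(in_Vh_bmeas mx vV).
rewrite big_mkord; apply: eq_bigr => j _.
case: vV => _ /(_ _ (ltn_ord j))[p sp vp].
have -> : oint (fun y => v y ^+ 2) (x j) (x j.+1) =
    oint (horner (p ^+ 2)) (x j) (x j.+1).
  by apply: eq_oint => y /vp ->; rewrite horner_exp.
rewrite (gauss_cell gxi)//.
  by apply: eq_bigr => a _; rewrite vp ?gauss_point_in// horner_exp mulrAC.
rewrite expr2 (leq_trans (size_polyMleq _ _))// -addnn.
by rewrite (leq_trans (leq_pred _))// leq_add.
Qed.

(** The cross term vanishes since [w - phi] lies in V_h. Dropping either term on the right gives the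
    stability of the projection or its best approximation property. *)
Lemma L2proj_pythagoras f w phi :
  bmeas f -> is_L2proj k N x f w -> in_Vh k N x phi ->
  oint (fun y => (f y - phi y) ^+ 2) 0 1 =
  oint (fun y => (f y - w y) ^+ 2) 0 1 + oint (fun y => (w y - phi y) ^+ 2) 0 1.
Proof.
move=> bf [wV orth] pV.
have bw := in_Vh_bmeas mx wV; have bp := in_Vh_bmeas mx pV.
have := orth _ (in_VhB wV pV); rewrite -[X in X = 0]/(oint _ 0 1) => o0.
have b1 := bmeas_sqr (bmeasB bf bw).
have b2 := bmeasM (bmeasB bf bw) (bmeasB bw bp).
have b2' := bmeasM (bmeas_cst 2) b2.
have b3 := bmeas_sqr (bmeasB bw bp).
transitivity (oint (fun y => (f y - w y) ^+ 2) 0 1 +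
    2 * oint (fun y => (f y - w y) * (w y - phi y)) 0 1 +
    oint (fun y => (w y - phi y) ^+ 2) 0 1); last by rewrite o0 mulr0 addr0.
rewrite -ointZ// -ointD// -ointD//; last exact: (bmeasD b1 b2').
by apply: eq_oint => y _; ring.
Qed.

Lemma L2proj_le f w phi : bmeas f -> is_L2proj k N x f w -> in_Vh k N x phi ->
  L2norm (fun y => w y - phi y) <= L2norm (fun y => f y - phi y).
Proof.
move=> bf fw pV; rewrite !L2normE ler_wsqrtr// (L2proj_pythagoras bf fw pV).
by rewrite lerDr oint_ge0// => y _; exact: sqr_ge0.
Qed.

Lemma L2proj_best f w phi : bmeas f -> is_L2proj k N x f w -> in_Vh k N x phi ->
  L2norm (fun y => f y - w y) <= L2norm (fun y => f y - phi y).
Proof.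
move=> bf fw pV; rewrite !L2normE ler_wsqrtr// (L2proj_pythagoras bf fw pV).
by rewrite lerDl oint_ge0// => y _; exact: sqr_ge0.
Qed.

(* Zero at the mesh points. *)
Definition gauss_interp w (y : R) : R :=
  \sum_(j < N) (x j < frac y < x j.+1)%R%:R * (interpolant (gp j) w).[frac y].

Lemma gauss_interpE w (j : 'I_N) (y : R) : x j < y < x j.+1 ->
  gauss_interp w y = (interpolant (gp j) w).[y].
Proof.
move=> yj; rewrite /gauss_interp frac_id; last first.
  have := mesh_ge0 mx (ltnW (ltn_ord j)); have := mesh_le1 mx (ltn_ord j).
  by move: yj; lra.
rewrite (bigD1 j)//= yj mul1r big1 ?addr0// => i ij.
suff /negbTE -> : ~~ (x i < y < x i.+1) by rewrite mul0r.
apply/negP => yi; move: ij yi yj; rewrite -val_eqE /= neq_ltn => /orP[] ij.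
- have : x i.+1 <= x j by apply: (mesh_le mx); rewrite ij ltnW.
  lra.
- have : x j.+1 <= x i by apply: (mesh_le mx); rewrite ij ltnW.
  lra.
Qed.

Lemma gauss_interp_node w (j : 'I_N) a : gauss_interp w (gp j a) = w (gp j a).
Proof.
rewrite (@gauss_interpE _ j) ?gauss_point_in// interpolant_node//.
exact: gauss_point_inj.
Qed.

Lemma gauss_interp_Vh w : in_Vh k N x (gauss_interp w).
Proof.
split=> [y|j jN].
  by rewrite /gauss_interp -[1]/(1%:~R) fracDz.
exists (interpolant (gp j) w); first exact: size_interpolant.
by move=> y yj; rewrite (@gauss_interpE _ (Ordinal jN)).
Qed.

Definition interp_err w : R := L2norm (fun y => w y - gauss_interp w y).

Lemma ler_dist_max (a b c d : R) :
  `|Num.max a b - Num.max c d| <= `|a - c| + `|b - d|.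
Proof.
rewrite ler_norml; have := ler_norm (a - c); have := ler_norm (b - d).
have := ler_norm (- (a - c)); have := ler_norm (- (b - d)); rewrite !normrN.
by case: (leP a b) => ?; case: (leP c d) => ?; lra.
Qed.

(** Norms are exchanged twice, each time at the cost of one interpolation error: around [u'], to
    reach the nodes where the maximum is nonexpansive, and around the translate [w] of [u], to
    return to L2 where the projection is. Translation preserves the L2 norm by periodicity. *)
Lemma sldg_step (s : R) (u u' uh uh' Gv gt gd : R -> R) :
  bmeas u -> periodic u 1 -> bmeas u' ->
  in_Vh k N x uh -> in_Vh k N x uh' ->
  is_L2proj k N x (fun y => uh (y - s)) Gv ->
  (forall (j : 'I_N) a, uh' (gp j a) = Num.max (Gv (gp j a)) (gt (gp j a))) ->
  (forall y, u' y = Num.max (u (y - s)) (gd y)) ->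
  L2norm (fun y => uh' y - u' y) <=
  L2norm (fun y => uh y - u y) + interp_err (fun y => u (y - s)) +
  interp_err u' + l2 (fun y => gt y - gd y).
Proof.
move=> bu uT bu' uhV uhV' Gvp uh'E u'E.
have GvV : in_Vh k N x Gv by case: Gvp.
have buh := in_Vh_bmeas mx uhV; have buh' := in_Vh_bmeas mx uhV'.
set w := (fun y => u (y - s)).
have bw : bmeas w by exact: bmeas_shift.
have bI f : bmeas (gauss_interp f) := in_Vh_bmeas mx (gauss_interp_Vh f).
have step1 : L2norm (fun y => uh' y - u' y) <=
    l2 (fun y => uh' y - u' y) + interp_err u'.
  rewrite (le_trans (ler_L2normB buh' (bI u') bu'))// lerD//.
    rewrite L2norm_Vh; last exact: (in_VhB uhV' (gauss_interp_Vh u')).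
    by apply: l2norm_le => j a; rewrite gauss_interp_node.
  by rewrite L2norm_distC.
have step2 : l2 (fun y => uh' y - u' y) <=
    l2 (fun y => Gv y - w y) + l2 (fun y => gt y - gd y).
  apply: (@le_trans _ _ (l2 (fun y => `|Gv y - w y| + `|gt y - gd y|))).
    apply: l2norm_le => j a; rewrite uh'E u'E [leRHS]ger0_norm ?addr_ge0//.
    exact: ler_dist_max.
  apply: (le_trans (ler_l2normD _ _)).
  by apply: lerD; apply: l2norm_le => j a; rewrite normr_id.
have step3 : l2 (fun y => Gv y - w y) <=
    L2norm (fun y => uh y - u y) + interp_err w.
  apply: (@le_trans _ _ (l2 (fun y => Gv y - gauss_interp w y))).
    by apply: l2norm_le => j a; rewrite gauss_interp_node.
  rewrite -L2norm_Vh; last exact: (in_VhB GvV (gauss_interp_Vh w)).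
  have buhs : bmeas (fun y => uh (y - s)) by exact: bmeas_shift.
  apply: (le_trans (L2proj_le buhs Gvp (gauss_interp_Vh w))).
  apply: (le_trans (ler_L2normB buhs bw (bI w))); rewrite lerD2r.
  rewrite (@L2norm_shift _ (fun y => uh y - u y) s)//; first exact: bmeasB.
  by move=> y; case: uhV => -> _; rewrite uT.
rewrite (le_trans step1)// [leRHS]addrAC lerD2r (le_trans step2)// lerD2r.
exact: step3.
Qed.

End Discrete.

(** * Exact solution and accumulation of errors *)

Section ExactSolution.
Variables (R : realType) (c : R) (u0 g : R -> R) (M : R).
Hypotheses (u0T : periodic u0 1) (gT : periodic g 1).
Hypothesis u0M : forall y z, `|u0 y - u0 z| <= M * `|y - z|.
Hypothesis gM : forall y z, `|g y - g z| <= M * `|y - z|.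

Lemma running_max_has_sup t y : 0 <= t ->
  has_sup [set g (y - c * s) | s in `[0, t]].
Proof.
move=> t0; split; first by exists (g (y - c * 0)), 0; rewrite //= in_itv/= lexx.
have [_ [K gK]] := klipschitz_bmeas gM gT.
by exists K => _ [s _ <-]; rewrite (le_trans (ler_norm _)).
Qed.

Lemma running_max_ub t y s : 0 <= s <= t -> g (y - c * s) <= running_max c g t y.
Proof.
move=> /andP[s0 st]; apply: ub_le_sup.
  by case: (running_max_has_sup y (le_trans s0 st)).
by exists s; rewrite //= in_itv/= s0.
Qed.

Lemma running_max_le t y B : 0 <= t ->
  (forall s, 0 <= s <= t -> g (y - c * s) <= B) -> running_max c g t y <= B.
Proof.
move=> t0 gB; apply: ge_sup; first by case: (running_max_has_sup y t0).
by move=> _ [s + <-]; rewrite /= in_itv/=; exact: gB.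
Qed.

(** The window is cut at [t2]: its later part is a window of length [t1] seen from [y - c * t2]. *)
Lemma running_maxD t1 t2 y : 0 <= t1 -> 0 <= t2 ->
  running_max c g (t1 + t2) y =
  Num.max (running_max c g t1 (y - c * t2)) (running_max c g t2 y).
Proof.
move=> t10 t20; apply/eqP; rewrite eq_le; apply/andP; split.
  apply: running_max_le => [|s /andP[s0 s12]]; first by rewrite addr_ge0.
  rewrite le_max; have [st2|t2s] := leP s t2.
    by rewrite (@running_max_ub t2) ?orbT ?s0.
  have -> : y - c * s = y - c * t2 - c * (s - t2) by ring.
  by rewrite running_max_ub//; lra.
rewrite ge_max; apply/andP; split; apply: running_max_le => // s /andP[s0 st].
  have -> : y - c * t2 - c * s = y - c * (t2 + s) by ring.
  by apply: running_max_ub; lra.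
by apply: running_max_ub; lra.
Qed.

Lemma running_max_lip t y z : 0 <= t ->
  `|running_max c g t y - running_max c g t z| <= M * `|y - z|.
Proof.
move=> t0.
have H a b : running_max c g t a <= running_max c g t b + M * `|a - b|.
  apply: running_max_le => // s st; rewrite -lerBlDr.
  rewrite (le_trans _ (@running_max_ub t b s st))// lerBlDr -lerBlDl.
  rewrite (le_trans (ler_norm _))// (le_trans (gM _ _))//.
  by have -> : a - c * s - (b - c * s) = a - b by ring.
rewrite ler_norml; have := H y z; have := H z y; rewrite (distrC z y); lra.
Qed.

Lemma running_max_periodic t : periodic (running_max c g t) 1.
Proof.
move=> y; rewrite /running_max; congr sup; apply: eq_imagel => s _.
by rewrite addrAC gT.
Qed.

(** Dynamic programming principle. At [t = 0] the solution is [u0] without obstacle, and the formula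
    still holds because the obstacle enters through [running_max c g dt]. *)
Lemma exact_solD t dt y : 0 <= t -> 0 < dt ->
  exact_sol c u0 g (t + dt) y =
  Num.max (exact_sol c u0 g t (y - c * dt)) (running_max c g dt y).
Proof.
move=> t0 dt0; rewrite /exact_sol (gt_eqF (_ : 0 < t + dt)) ?ltr_wpDl//.
have [->|tn0] := eqVneq t 0; first by rewrite add0r.
rewrite running_maxD// ?(ltW dt0)// maxA; congr (Num.max (Num.max (u0 _) _) _).
ring.
Qed.

Lemma exact_sol_lip t y z : 0 <= t ->
  `|exact_sol c u0 g t y - exact_sol c u0 g t z| <= M * `|y - z|.
Proof.
move=> t0; rewrite /exact_sol; case: ifP => _; first exact: u0M.
have := running_max_lip y z t0; have := u0M (y - c * t) (z - c * t).
have -> : y - c * t - (z - c * t) = y - z by ring.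
rewrite !ler_norml => /andP[? ?] /andP[? ?].
by case: (leP (u0 (y - _)) (running_max c g t y)) => ?;
   case: (leP (u0 (z - _)) (running_max c g t z)) => ?; lra.
Qed.

Lemma exact_sol_periodic t : periodic (exact_sol c u0 g t) 1.
Proof.
move=> y; rewrite /exact_sol addrAC u0T running_max_periodic.
by case: ifP => // _; rewrite u0T.
Qed.

Lemma exact_sol_bmeas t : 0 <= t -> bmeas (exact_sol c u0 g t).
Proof.
move=> t0; apply: (@klipschitz_bmeas _ _ M); last exact: exact_sol_periodic.
by move=> y z; exact: exact_sol_lip.
Qed.

Section Accumulation.
Variables (k N : nat) (x : nat -> R) (xi : 'I_k.+1 -> R).
Hypotheses (mx : is_mesh N x) (gxi : is_gauss_nodes xi).
Variables (T dt e : R) (gt : R -> R) (uh : nat -> R -> R).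
Hypotheses (dt0 : 0 < dt) (dtT : dt <= T).
Hypothesis e_err : forall t s, 0 <= t <= T ->
  interp_err N x xi (fun y => exact_sol c u0 g t (y - s)) <= e.
Hypothesis sldg : is_sldg N x xi c dt u0 gt uh.
Local Notation u n := (exact_sol c u0 g (n%:R * dt)).
Local Notation d := (l2norm N x xi (fun y => gt y - running_max c g dt y)).

Let err0 t : 0 <= t <= T -> interp_err N x xi (exact_sol c u0 g t) <= e.
Proof.
move=> tT; have := e_err 0 tT.
by under [X in interp_err _ _ _ X]funext => y do rewrite subr0.
Qed.

Lemma sldg_Vh n : in_Vh k N x (uh n).
Proof. by case: n => [|n]; case: sldg => [[? _] /(_ _)]// H; case: (H n). Qed.

(** Of the 2n + 1 interpolation errors, one comes from the initial projection, which is at least as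
    good as the interpolant, and two from each step. *)
Lemma sldg_error_steps n : n%:R * dt <= T ->
  L2norm (fun y => uh n y - u n y) <= (n.*2.+1)%:R * e + n%:R * d.
Proof.
have T0 : 0 <= T by rewrite ltW// (lt_le_trans dt0).
elim: n => [_|n IH nT].
  rewrite !mul0r addr0 mul1r; case: sldg => [P0 _].
  have E0 : exact_sol c u0 g 0 = u0.
    by apply/funext => y; rewrite /exact_sol eqxx.
  have bu0 : bmeas u0 by exact: klipschitz_bmeas u0M u0T.
  have IV := gauss_interp_Vh xi mx u0.
  apply: le_trans (@err0 0 _); last by rewrite lexx.
  by rewrite E0 L2norm_distC /interp_err; exact: (L2proj_best mx bu0 P0 IV).
have n0 : 0 <= n%:R * dt :> R by rewrite mulr_ge0// ltW.
have nS : n.+1%:R * dt = n%:R * dt + dt by rewrite -natr1 mulrDl mul1r.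
have nT' : n%:R * dt <= T by rewrite (le_trans _ nT)// nS lerDl ltW.
have n1 : 0 <= n.+1%:R * dt by rewrite mulr_ge0// ltW.
case: sldg => _ /(_ n)[uhV' [Gv Gvp uh'E]].
have H := @sldg_step R k N x xi mx gxi (c * dt) (u n) (u n.+1) (uh n)
  (uh n.+1) Gv gt (running_max c g dt) (exact_sol_bmeas n0)
  (exact_sol_periodic _) (exact_sol_bmeas n1) (sldg_Vh n) uhV' Gvp
  (fun j a => uh'E j a (ltn_ord j)).
rewrite nS in H *.
apply: (le_trans (H _)) => [y|]; first exact: exact_solD.
have e1 := e_err (c * dt) (introT andP (conj n0 nT')).
have e2 := @err0 (n%:R * dt + dt).
rewrite -nS n1 nT in e2; have {}e2 := e2 isT; rewrite nS in e2.
have {}IH := IH nT'.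
have -> : (n.+1.*2.+1)%:R = (n.*2.+1)%:R + 2 :> R.
  by rewrite doubleS -natrD; congr _%:R; rewrite addn2.
rewrite -(natr1 n).
have -> : (n.*2.+1%:R + 2) * e + (n%:R + 1) * d =
    n.*2.+1%:R * e + n%:R * d + e + e + d by ring.
by rewrite lerD2r (lerD _ e2) ?(lerD IH e1).
Qed.

(** Both [n] and 1 are at most [T / dt], the latter because [dt <= T]; hence 2n + 1 <= 3 T / dt. *)
Lemma sldg_error n : n%:R * dt <= T ->
  L2norm (fun y => uh n y - u n y) <= 3 * (T / dt * e) + T / dt * d.
Proof.
move=> nT; apply: (le_trans (sldg_error_steps nT)).
have T0 : 0 <= T by rewrite ltW// (lt_le_trans dt0).
have e0 : 0 <= e.
  by apply: le_trans (@err0 0 _); [exact: L2norm_ge0|rewrite lexx].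
have d0 : 0 <= d by exact: sqrtr_ge0.
have nTd : n%:R <= T / dt by rewrite ler_pdivlMr.
have T1 : 1 <= T / dt by rewrite ler_pdivlMr// mul1r.
apply: lerD; last exact: ler_wpM2r.
by rewrite mulrA ler_wpM2r// -addn1 -muln2 natrD natrM; lra.
Qed.

End Accumulation.
End ExactSolution.

(** * Interpolation error *)

Section DerivativeBounds.
Variable R : realType.
Implicit Types (f v : R -> R) (a b s t y z : R).

Lemma is_derive_MVT f df a b y z :
  (forall s, a < s < b -> is_derive s 1 f (df s)) ->
  a < y -> y < z -> z < b ->
  exists2 s, y < s < z & f z - f y = df s * (z - y).
Proof.
move=> fdf ay yz zb.
have fyz s : s \in `[y, z] -> is_derive s 1 f (df s).
  by rewrite in_itv/= => sI; apply: fdf; lra.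
have fc : {within `[y, z], continuous f}.
  by apply: derivable_within_continuous => s sI; have := fyz _ sI; case.
have fyz' s : s \in `]y, z[ -> is_derive s 1 f (df s).
  by move=> sI; apply: fyz; exact: subset_itv_oo_cc sI.
have [s sI E] := MVT yz fyz' fc.
by exists s => //; move: sI; rewrite in_itv.
Qed.

Lemma is_derive_incr f df a b B y z :
  (forall s, a < s < b -> is_derive s 1 f (df s)) ->
  (forall s, a < s < b -> `|df s| <= B) ->
  a < y < b -> a < z < b -> `|f z - f y| <= B * `|z - y|.
Proof.
move=> fdf dfB /andP[ay yb] /andP[az zb].
have [yz|zy|->] := ltgtP y z; last by rewrite !subrr normr0 mulr0.
- have [s /andP[ys sz] ->] := is_derive_MVT fdf ay yz zb.
  by rewrite normrM ler_wpM2r// dfB// (lt_trans ay)//= (lt_trans sz).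
- have [s /andP[ys sz] E] := is_derive_MVT fdf az zy yb.
  rewrite distrC E distrC normrM ler_wpM2r// dfB// (lt_trans az)//=.
  exact: (lt_trans sz).
Qed.

(* In every subinterval of length [t - s] the derivatives are somewhere
   controlled by the sup norm of the function: split into thirds, and apply the
   mean value theorem between points of the outer thirds. *)
Lemma small_derivative_point (i : nat) : exists2 K : R, 0 <= K &
  forall (F : nat -> R -> R) a b M, 0 <= M ->
    (forall j y, (j < i)%N -> a < y < b -> is_derive y 1 (F j) (F j.+1 y)) ->
    (forall y, a < y < b -> `|F 0%N y| <= M) ->
  forall s t, a <= s -> s < t -> t <= b ->
    exists2 y, s < y < t & `|F i y| <= K * (M / (t - s) ^+ i).
Proof.
elim: i => [|i [K K0 IH]].
  exists 1 => // F a b M M0 _ FM s t as_ st tb; exists ((s + t) / 2); first lra.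
  by rewrite expr0 divr1 mul1r FM//; lra.
(* Two values bounded by K M / u^i with u = (t - s) / 3, divided by a distance at least u. *)
exists (2 * K * 3 ^+ i.+1); first by rewrite !mulr_ge0// exprn_ge0.
move=> F a b M M0 dF FM s t as_ st tb.
have dFi : forall j y, (j < i)%N -> a < y < b -> is_derive y 1 (F j) (F j.+1 y).
  by move=> j y ji; apply: dF; rewrite ltnW.
pose u := (t - s) / 3.
have u0 : 0 < u by rewrite /u; lra.
have su : t - s = 3 * u by rewrite /u; lra.
clearbody u.
have [||//|y1 y1I Hy1] := IH F a b M M0 dFi FM s (s + u); [lra|lra|lra|].
have [||//|y2 y2I Hy2] := IH F a b M M0 dFi FM (t - u) t; [lra|lra|].
have y12 : u <= y2 - y1 by lra.
have [||||y yI E] := @is_derive_MVT (F i) (F i.+1) a b y1 y2; [|lra|lra|lra|].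
  by move=> y yab; apply: dF.
exists y; first lra.
have y120 : 0 < y2 - y1 by lra.
rewrite -(ler_pM2r y120) -[X in _ * X <= _]gtr0_norm// -normrM -E.
have us : s + u - s = u by lra.
have ut : t - (t - u) = u by lra.
rewrite us in Hy1; rewrite ut in Hy2.
apply: (le_trans (ler_normB _ _)).
apply: (@le_trans _ _ (2 * (K * (M / u ^+ i)))); first by lra.
rewrite su exprMn (exprSr u).
have -> : 2 * K * 3 ^+ i.+1 * (M / (3 ^+ i.+1 * (u ^+ i * u))) * (y2 - y1) =
   2 * (K * (M / u ^+ i)) * ((y2 - y1) / u).
  by field; rewrite gt_eqF// expf_neq0// ?gt_eqF.
rewrite ler_peMr//; last by rewrite ler_pdivlMr// mul1r.
by rewrite !mulr_ge0// invr_ge0 exprn_ge0// ltW.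
Qed.

(* Landau-Kolmogorov inequality, by descending induction on the order: the
   derivative of order n - m is controlled at one point by
   [small_derivative_point], and its increments by the next derivative. *)
Lemma intermediate_derivatives (n m : nat) : (m <= n)%N ->
  exists2 C : R, 0 <= C &
  forall (F : nat -> R -> R) a b M c0, 0 <= M -> 0 <= c0 -> b - a <= 1 ->
    (forall j y, (j < n)%N -> a < y < b -> is_derive y 1 (F j) (F j.+1 y)) ->
    (forall y, a < y < b -> `|F 0%N y| <= M) ->
    (forall y, a < y < b -> `|F n y| <= c0) ->
  forall y, a < y < b ->
    `|F (n - m)%N y| <= C * (M / (b - a) ^+ (n - m) + c0).
Proof.
elim: m => [_|m IH mn].
  exists 1 => // F a b M c0 M0 c00 ab1 dF FM Fc y yab; rewrite subn0 mul1r.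
  rewrite (le_trans (Fc _ yab))// lerDr mulr_ge0// invr_ge0 exprn_ge0//; lra.
have [C C0 HC] := IH (ltnW mn).
set i := (n - m.+1)%N; have nmi : (n - m)%N = i.+1 by rewrite /i -subSS subSn.
have iln : (i < n)%N by rewrite /i ltn_subrL; case: (n) mn.
have [K K0 HK] := small_derivative_point i.
(* [K] bounds the value at one point. [C] bounds the increment: multiplying the next bound by the
   length [b - a] gains one power of it, and [b - a <= 1] keeps the [c0] term. *)
exists (K + C); first by rewrite addr_ge0.
move=> F a b M c0 M0 c00 ab1 dF FM Fc y yab.
have dl0 : 0 < b - a by lra.
have [||||z zab Hz] := HK F a b M M0 _ FM a b => //; [|lra|].
  by move=> j w ji; apply: dF; apply: ltn_trans iln.
have H1 w : a < w < b -> `|F i.+1 w| <= C * (M / (b - a) ^+ i.+1 + c0).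
  by rewrite -nmi; exact: HC.
have := @is_derive_incr (F i) (F i.+1) a b _ z y (fun s sab => dF i s iln sab)
  H1 zab yab.
have yz1 : `|y - z| <= b - a by rewrite ler_norml; lra.
have Mi0 : 0 <= M / (b - a) ^+ i by rewrite divr_ge0// exprn_ge0// ltW.
have B0 : 0 <= C * (M / (b - a) ^+ i.+1 + c0).
  by rewrite mulr_ge0// addr_ge0// divr_ge0// exprn_ge0// ltW.
move=> Hinc; have {}Hinc := le_trans Hinc (ler_wpM2l B0 yz1).
have EB : C * (M / (b - a) ^+ i.+1 + c0) * (b - a) =
    C * (M / (b - a) ^+ i + c0 * (b - a)).
  by rewrite exprSr; field; rewrite expf_neq0 gt_eqF.
rewrite EB in Hinc.
have cd : C * (c0 * (b - a)) <= C * c0 by rewrite ler_wpM2l// ler_piMr.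
have Kc : 0 <= K * c0 by rewrite mulr_ge0.
have Hy : `|F i y| <= `|F i z| + `|F i y - F i z|.
  by rewrite -[X in `|X| <= _](subrK (F i z)) addrC ler_normD.
rewrite mulrDr in Hinc; rewrite !mulrDl !mulrDr.
move: Hz Hinc Hy cd Kc; move: (`|F i y|) (`|F i z|) (`|F i y - F i z|).
move: (K * (M / _)) (C * (M / _)) (K * c0) (C * c0) (C * (c0 * _)) => *; lra.
Qed.

Lemma klipschitz_derive1_le v M y : derivable v y 1 ->
  (forall s t, `|v s - v t| <= M * `|s - t|) -> `|derive1 v y| <= M.
Proof.
move=> dv vM; rewrite derive1E /derive.
have H : \forall h \near (0 : R)^', `|h^-1 *: ((v \o shift y) (h *: 1) - v y)| <= M.
  near=> h; have h0 : h != 0 by near: h; exact: nbhs_dnbhs_neq.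
  rewrite /= normrZ normfV ler_pdivrMl ?normr_gt0// mulrC.
  rewrite (le_trans (vM _ _))// addrK [h *: 1]mulr1.
  by [].
rewrite ler_norml; apply/andP; split.
- apply: limr_ge; first exact: dv.
  by apply: filterS H => h; rewrite ler_norml => /andP[].
- apply: limr_le; first exact: dv.
  by apply: filterS H => h; rewrite ler_norml => /andP[].
Unshelve. all: by end_near. Qed.

(** The mean value inequality is applied twice, to the first derivative and then to the function
    minus its linear part. *)
Lemma affine_approx (F : nat -> R -> R) a b B y z :
  (forall j s, (j < 2)%N -> a < s < b -> is_derive s 1 (F j) (F j.+1 s)) ->
  (forall s, a < s < b -> `|F 2%N s| <= B) ->
  a < y < b -> a < z < b ->
  `|F 0%N z - (F 0%N y + F 1%N y * (z - y))| <= B * (b - a) ^+ 2.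
Proof.
move=> dF FB yab zab.
have B0 : 0 <= B by rewrite (le_trans _ (FB _ yab)).
have H1 s : a < s < b -> `|F 1%N s - F 1%N y| <= B * (b - a).
  move=> sab; rewrite (le_trans (is_derive_incr (fun s => dF 1%N s isT) FB yab sab))//.
  by rewrite ler_wpM2l// ler_norml; lra.
have dG s : a < s < b ->
    is_derive s 1 (fun z => F 0%N z - F 1%N y * z) (F 1%N s - F 1%N y).
  move=> sab; have D0 := dF 0%N s isT sab.
  by apply: is_derive_eq; rewrite /GRing.scale/= mulr1.
have := is_derive_incr dG H1 yab zab.
have zy : `|z - y| <= b - a by rewrite ler_norml; lra.
have B1 : 0 <= B * (b - a) by rewrite mulr_ge0//; lra.
move=> /le_trans/(_ (ler_wpM2l B1 zy)).
by rewrite -mulrA -expr2; congr (`|_| <= _); ring.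
Qed.

End DerivativeBounds.

(** * Regularity under translation, almost everywhere bounds, finite sets *)

Section Translation.
Variable R : realType.
Implicit Types (f v : R -> R) (a b s t y z : R).

Lemma derive1_shift v s :
  derive1 (fun y => v (y - s)) = (fun y => derive1 v (y - s)).
Proof.
apply/funext => y; rewrite /derive1; set d := (fun h => _); set d' := (fun h => _).
by suff -> : d = d' by []; apply/funext => h; rewrite /d /d' addrA.
Qed.

Lemma derive1n_shift n v s :
  derive1n n (fun y => v (y - s)) = (fun y => derive1n n v (y - s)).
Proof. by elim: n => [//|n IH]; rewrite derive1nS IH derive1_shift -derive1nS. Qed.

Lemma derivable_shift v s y :
  derivable v (y - s) 1 -> derivable (fun y => v (y - s)) y 1.
Proof.
rewrite /derivable; set d := (fun h => _); set d' := (fun h => _).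
by suff -> : d = d' by []; apply/funext => h; rewrite /d /d' /= addrA.
Qed.

Lemma near_shift (P : R -> Prop) s y :
  (\forall z \near y - s, P z) -> \forall z \near y, P (z - s).
Proof.
have : (fun z => z - s) @ y --> y - s.
  by apply: cvgB; [exact: cvg_id|exact: cvg_cst].
by move=> /(_ P).
Qed.

Lemma regular_at_shift m v s y :
  regular_at m v (y - s) -> regular_at m (fun y => v (y - s)) y.
Proof.
move=> /near_shift; rewrite /regular_at; apply: filterS => z [dv cv]; split.
  by move=> i im; rewrite derive1n_shift; apply: derivable_shift; exact: dv.
rewrite derive1n_shift.
apply: (@continuous_comp _ _ _ (fun z => z - s) (derive1n m v)); last exact: cv.
by apply: cvgB; [exact: cvg_id|exact: cvg_cst].
Qed.

Lemma periodic_shiftz v (n : int) : periodic v 1 -> (fun y => v (y - n%:~R)) = v.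
Proof. by move=> vT; apply/funext => y; rewrite -mulrNz periodicz. Qed.

Lemma regular_at_frac m v y : periodic v 1 ->
  regular_at m v (frac y) <-> regular_at m v y.
Proof.
move=> vT; rewrite /frac; split => [/regular_at_shift|].
  by rewrite periodic_shiftz.
move=> vr; rewrite -(periodic_shiftz (- Num.floor y) vT).
by apply: regular_at_shift; rewrite mulrNz opprK subrK.
Qed.

Lemma derive1n_frac m v y : periodic v 1 ->
  derive1n m v (frac y) = derive1n m v y.
Proof.
move=> vT.
by have /(congr1 (@^~ y)) := derive1n_shift m v (Num.floor y)%:~R;
  rewrite periodic_shiftz.
Qed.

Lemma lebesgue_ae_dense (P : R -> Prop) a b : a < b ->
  {ae lebesgue_measure, forall y, P y} -> exists2 y, a < y < b & P y.
Proof.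
move=> ab [A [mA A0 PA]]; apply: contrapT => nP.
have abA : `]a, b[ `<=` A.
  move=> y; rewrite /= in_itv/= => yab; apply: PA => /= Py; apply: nP.
  by exists y.
have : (lebesgue_measure (`]a, b[%classic : set R) <= 0)%E.
  by rewrite -A0; apply: le_measure; rewrite ?inE.
by rewrite lebesgue_measure_itv/= lte_fin ab -EFinB lee_fin leNgt subr_gt0 ab.
Qed.

(** The class gives the bound only almost everywhere on (0, 1). At a regular point the derivative is
    continuous, so an excess over [c0] would persist on an open interval. The interval is taken to
    the right of [z], which may be 0. *)
Lemma regular_derivative_bound l p L c0 v y : periodic v 1 ->
  piecewise_regular l p L c0 v -> regular_at l.+1 v y ->
  `|derive1n l.+1 v y| <= c0.
Proof.
move=> vT [_ _ aev _] /(regular_at_frac _ _ vT); rewrite -derive1n_frac//.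
have /andP[y0 y1] := frac_itv y; set z := frac y in y0 y1 *.
move=> /nbhs_singleton[_ cv]; rewrite leNgt; apply/negP => c0v.
have : \forall w \near z, c0 < `|derive1n l.+1 v w|.
  have cn : (fun w => `|derive1n l.+1 v w|) @ z --> `|derive1n l.+1 v z|.
    by apply: cvg_norm; exact: cv.
  exact: (cvgr_gt _ cn).
move=> /nbhs_ballP[e /= e0 He].
have [|w /andP[zw wz] Pw] := @lebesgue_ae_dense _ z (Num.min (z + e) 1) _ aev.
  by rewrite lt_min ltrDl e0.
move: wz; rewrite lt_min => /andP[we w1].
have w01 : 0 < w < 1 by rewrite w1 (le_lt_trans y0).
have := Pw w01; apply/negP; rewrite -ltNge; apply: He.
by rewrite /ball/= ltr_norml; lra.
Qed.

(** The list inverts an injection into [I_p]. Indices outside its image give the default 0, so the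
    list may contain a point outside [A]. *)
Lemma card_le_seq (A : set R) p : (A #<= `I_p)%card ->
  exists2 S : seq R, (size S <= p)%N & forall y, A y -> y \in S.
Proof.
move=> /pcard_leP[f].
exists [seq xget 0 [set y | A y /\ f y = i] | i <- iota 0 p].
  by rewrite size_map size_iota.
move=> y Ay; apply/mapP; exists (f y).
  by rewrite mem_iota add0n/=; have /= := @funS _ _ _ _ f _ Ay.
have [Az fz] := @xgetPex R 0 [set z | A z /\ f z = f y]
  (ex_intro _ y (conj Ay erefl)).
by apply: (@inj _ _ _ f); rewrite ?inE.
Qed.

End Translation.

Lemma le_oint_horner (R : realType) (f : R -> R) (p : {poly R}) (a b : R) :
  bmeas f -> (forall y, a < y < b -> f y <= p.[y]) ->
  oint f a b <= oint (horner p) a b.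
Proof.
move=> bf fp.
have ip : lebesgue_measure.-integrable `]a, b[%classic (EFin \o horner p).
  have ipc : lebesgue_measure.-integrable `[a, b]%classic (EFin \o horner p).
    apply: continuous_compact_integrable; first exact: segment_compact.
    by apply: continuous_subspaceT; exact: continuous_horner.
  by apply: integrableS ipc => //; exact: subset_itv_oo_cc.
by apply: le_Rintegral => //; exact: bmeas_integrable.
Qed.

(** * Interpolation error cell by cell, and its summation over the mesh *)

Section CellError.
Variables (R : realType) (k N : nat) (x : nat -> R) (xi : 'I_k.+1 -> R).
Hypotheses (mx : is_mesh N x) (gxi : is_gauss_nodes xi).
Variable w : R -> R.
Hypothesis bw : bmeas w.
Local Notation h := (mesh_size N x).

Definition cell_err (j : nat) : R :=
  oint (fun y => (w y - gauss_interp N x xi w y) ^+ 2) (x j) (x j.+1).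

Lemma interp_err_sqr : interp_err N x xi w ^+ 2 = \sum_(0 <= j < N) cell_err j.
Proof.
rewrite /interp_err L2norm_sqr (oint_mesh mx)//; apply: bmeas_sqr.
exact: bmeasB (in_Vh_bmeas mx (gauss_interp_Vh xi mx w)).
Qed.

(* The weights are nonnegative with sum 1, so interpolation is bounded from the
   sup norm to the L2 norm with constant 1, whatever the degree. *)
Lemma cell_err_le (j : nat) (p : {poly R}) (s : R) : (j < N)%N ->
  (size p <= k.+1)%N ->
  (forall y, x j < y < x j.+1 -> `|w y - p.[y]| <= s) ->
  cell_err j <= 4 * s ^+ 2 * (x j.+1 - x j).
Proof.
move=> jN sp wp; have xj : x j < x j.+1 by case: mx => _ _; exact.
pose q := interpolant (gauss_point x xi j) w.
have sq : (size q <= k.+1)%N := size_interpolant _ _.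
have mid : x j < (x j + x j.+1) / 2 < x j.+1 by lra.
have s0 : 0 <= s := le_trans (normr_ge0 _) (wp _ mid).
have sqr_le y : x j < y < x j.+1 -> (w y - p.[y]) ^+ 2 <= s ^+ 2.
  by move=> /wp wps; rewrite -real_normK ?num_real// ler_pXn2r ?nnegrE.
have bI := in_Vh_bmeas mx (gauss_interp_Vh xi mx w).
(* (w - q)^2 <= 2 (w - p)^2 + 2 (p - q)^2. The second square has degree at most 2k, so its integral
   is a sum over the nodes, where q = w; each term contributes 2 s^2 per unit length. *)
apply: (@le_trans _ _ (oint (horner ((2 * s ^+ 2)%:P +
    2 *: (p - q) ^+ 2)) (x j) (x j.+1))).
  apply: le_oint_horner; first exact/bmeas_sqr/bmeasB.
  move=> y yj; rewrite (@gauss_interpE R k N x xi mx w (Ordinal jN)) -/q//=.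
  rewrite hornerD hornerC hornerZ horner_exp hornerD hornerN.
  have := sqr_le y yj.
  have := sqr_ge0 (w y - p.[y] - (p.[y] - q.[y])).
  by rewrite !expr2; lra.
rewrite oint_hornerD// oint_hornerZ//.
have -> : oint (horner (2 * s ^+ 2)%:P) (x j) (x j.+1) =
    2 * s ^+ 2 * (x j.+1 - x j).
  by rewrite -(oint_cst _ (ltW xj)); apply: eq_oint => y _; rewrite hornerC.
rewrite (gauss_cell gxi)//; last first.
  have spq : (size (p - q)%R <= k.+1)%N.
    by rewrite (leq_trans (size_polyD _ _))// size_polyN geq_max sp.
  rewrite expr2 (leq_trans (size_polyMleq _ _))// -addnn.
  by rewrite (leq_trans (leq_pred _))// leq_add.
have hj0 : 0 <= x j.+1 - x j by rewrite subr_ge0 ltW.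
have : \sum_(a < k.+1) gauss_weight xi a *
      ((p - q) ^+ 2).[gauss_point x xi j a] * (x j.+1 - x j) <=
    \sum_(a < k.+1) gauss_weight xi a * s ^+ 2 * (x j.+1 - x j).
  apply: ler_sum => a _; rewrite ler_wpM2r// ler_wpM2l ?gauss_weight_ge0//.
  rewrite horner_exp hornerD hornerN interpolant_node; last exact: gauss_point_inj.
  by rewrite -sqrrN opprB sqr_le// gauss_point_in.
rewrite -!mulr_suml (sum_gauss_weight gxi) mul1r; lra.
Qed.

Lemma cell_err_lip M j : (j < N)%N ->
  (forall y z, `|w y - w z| <= M * `|y - z|) ->
  cell_err j <= 4 * (M * (x j.+1 - x j)) ^+ 2 * (x j.+1 - x j).
Proof.
move=> jN wM; have xj : x j < x j.+1 by case: mx => _ _; exact.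
have M0 : 0 <= M by have := wM 1 0; rewrite subr0 normr1 mulr1; exact: le_trans.
apply: (@cell_err_le _ (w (x j))%:P) => //.
  by rewrite (leq_trans (size_polyC_leq1 _)).
move=> y yj; rewrite hornerC (le_trans (wM _ _))// ler_wpM2l// ler_norml; lra.
Qed.

Lemma interp_err_lip M : (forall y z, `|w y - w z| <= M * `|y - z|) ->
  interp_err N x xi w <= 2 * M * h.
Proof.
move=> wM.
have M0 : 0 <= M by have := wM 1 0; rewrite subr0 normr1 mulr1; exact: le_trans.
have h0 := ltW (mesh_size_gt0 mx).
rewrite -(@ler_pXn2r _ 2) ?nnegrE ?L2norm_ge0 ?mulr_ge0// interp_err_sqr.
apply: (@le_trans _ _ (\sum_(0 <= j < N) (2 * M * h) ^+ 2 * (x j.+1 - x j))).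
  apply: ler_sum_nat => j /andP[_ jN]; apply: (le_trans (cell_err_lip jN wM)).
  have hj := le_mesh_size x jN.
  have hj0 : 0 <= x j.+1 - x j by rewrite subr_ge0 ltW//; case: mx => _ _; exact.
  have -> : 4 * (M * (x j.+1 - x j)) ^+ 2 = (2 * M * (x j.+1 - x j)) ^+ 2 by ring.
  by rewrite ler_wpM2r// ler_pXn2r ?nnegrE ?mulr_ge0// ler_wpM2l// mulr_ge0.
rewrite -mulr_sumr (mesh_lengths (N := N)) ?leqnn//.
by case: mx => -> -> _; rewrite subr0 mulr1.
Qed.

(** The comparison polynomial is the tangent at the midpoint: derivatives are available only in the
    open cell, as a mesh point may be singular. *)
Lemma cell_err_affine B F j : (0 < k)%N -> (j < N)%N ->
  (F 0%N = w) ->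
  (forall i s, (i < 2)%N -> x j < s < x j.+1 -> is_derive s 1 (F i) (F i.+1 s)) ->
  (forall s, x j < s < x j.+1 -> `|F 2%N s| <= B) ->
  cell_err j <= 4 * (B * (x j.+1 - x j) ^+ 2) ^+ 2 * (x j.+1 - x j).
Proof.
move=> k0 jN F0 dF FB; have xj : x j < x j.+1 by case: mx => _ _; exact.
set z := (x j + x j.+1) / 2; have zj : x j < z < x j.+1 by rewrite /z; lra.
apply: (@cell_err_le _ ((w z)%:P + F 1%N z *: ('X - z%:P))) => //.
  rewrite (leq_trans (size_polyD _ _))// geq_max.
  rewrite (leq_trans (size_polyC_leq1 _))//=.
  by rewrite (leq_trans (size_scale_leq _ _))// size_XsubC ltnS.
move=> y yj; rewrite hornerD hornerC hornerZ hornerXsubC -F0.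
exact: affine_approx dF FB zj yj.
Qed.

(* On an interval (x_a, x_b) of length [dl] free of singular points,
   |w''| <= C (M / dl + c0), hence a cell error O(h^3 h_j / dl). *)
Lemma piece_err (C M c0 : R) (a b : nat) (F : nat -> R -> R) :
  0 <= C -> 0 <= M -> 0 <= c0 -> (0 < k)%N -> (a < b <= N)%N -> F 0%N = w ->
  (forall i s, (i < 2)%N -> x a < s < x b -> is_derive s 1 (F i) (F i.+1 s)) ->
  (forall s, x a < s < x b -> `|F 2%N s| <= C * (M / (x b - x a) + c0)) ->
  \sum_(a <= j < b) cell_err j <= 4 * (C * (M + c0)) ^+ 2 * h ^+ 3.
Proof.
move=> C0 M0 c00 k0 /andP[ab bN] F0 dF FB.
have aN : (a < N)%N := leq_trans ab bN.
have xab : x a < x b.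
  apply: (@lt_le_trans _ _ (x a.+1)); first by case: mx => _ _; exact.
  by apply: (mesh_le mx); rewrite ab.
set dl := x b - x a in FB *.
have dl0 : 0 < dl by rewrite subr_gt0.
have dl1 : dl <= 1.
  by rewrite /dl; have := mesh_ge0 mx (ltnW aN); have := mesh_le1 mx bN; lra.
have h0 := mesh_size_gt0 mx.
set K := C * (M + c0); have K0 : 0 <= K by rewrite mulr_ge0// addr_ge0.
apply: (@le_trans _ _ (\sum_(a <= j < b)
    4 * K ^+ 2 * h ^+ 3 / dl * (x j.+1 - x j))); last first.
  rewrite -mulr_sumr (mesh_lengths (N := N)) ?(ltnW ab)//.
  by rewrite divfK// gt_eqF.
apply: ler_sum_nat => j /andP[aj jb].
have jN : (j < N)%N := leq_trans jb bN.
have xj : x j < x j.+1 by case: mx => _ _; exact.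
have xaj : x a <= x j by apply: (mesh_le mx); rewrite aj ltnW.
have xjb : x j.+1 <= x b by apply: (mesh_le mx); rewrite jb.
have sub s : x j < s < x j.+1 -> x a < s < x b by lra.
set hj := x j.+1 - x j.
have hj0 : 0 < hj by rewrite subr_gt0.
have hjd : hj <= dl by rewrite /hj /dl; lra.
have hjh : hj <= h := le_mesh_size x jN.
apply: (le_trans (@cell_err_affine (C * (M / dl + c0)) F j k0 jN F0 _ _)).
- by move=> i s i2 /sub; exact: dF.
- by move=> s /sub; exact: FB.
rewrite ler_wpM2r ?(ltW hj0)//.
(* [dl <= 1] lets [c0] be put over [dl] as well. *)
have BK : C * (M / dl + c0) <= K / dl.
  rewrite /K -mulrA ler_wpM2l// mulrDl lerD2l ler_pdivlMr//.
  by rewrite ler_piMr.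
have B0 : 0 <= C * (M / dl + c0).
  by rewrite mulr_ge0// addr_ge0// divr_ge0// ltW.
apply: (@le_trans _ _ (4 * (K / dl * hj ^+ 2) ^+ 2)).
  have h20 : 0 <= hj ^+ 2 by exact: sqr_ge0.
  have P1 := mulr_ge0 B0 h20.
  have BKh := ler_wpM2r h20 BK; have P2 := le_trans P1 BKh.
  by rewrite ler_wpM2l// ler_pXn2r ?nnegrE.
(* The ratio [hj / dl] is set apart to be bounded by 1; the remaining [dl] cancels when the cell
   lengths are summed. *)
have -> : 4 * (K / dl * hj ^+ 2) ^+ 2 = 4 * K ^+ 2 / dl * (hj ^+ 3 * (hj / dl)).
  by field; rewrite gt_eqF.
have -> : 4 * K ^+ 2 * h ^+ 3 / dl = 4 * K ^+ 2 / dl * (h ^+ 3 * 1).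
  by field; rewrite gt_eqF.
have K20 : 0 <= 4 * K ^+ 2 / dl.
  by rewrite divr_ge0 ?(ltW dl0)// mulr_ge0// sqr_ge0.
rewrite ler_wpM2l//; apply: ler_pM; rewrite ?exprn_ge0 ?divr_ge0 ?(ltW dl0) ?(ltW hj0)//.
- by rewrite ler_pXn2r ?nnegrE ?(ltW h0) ?(ltW hj0).
- by rewrite ler_pdivrMr// mul1r.
Qed.

(* Strong induction on the number of singular points in (x_a, x_b): the cell of
   one of them is estimated separately and cuts the interval in two. *)
Lemma cut_at_singular_points (K : R) (S : seq R) :
  (forall j, (j < N)%N -> cell_err j <= K) ->
  (forall a b, (a < b <= N)%N -> (forall s, s \in S -> ~~ (x a < s < x b)) ->
    \sum_(a <= j < b) cell_err j <= K) ->
  0 <= K -> (forall s, s \in S -> 0 <= s < 1) ->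
  \sum_(0 <= j < N) cell_err j <= K * (2 * size S).+1%:R.
Proof.
(* With m singular points there are at most m cells set apart and m + 1 stretches between them,
   hence 2m + 1 terms. Here [u] and [v] count the points on either side of the removed cell, and [q]
   is the multiplicity of the chosen one. *)
have arith (u v q r m : nat) : (u + v + q <= r)%N -> (0 < q)%N -> (r <= m)%N ->
    [/\ (u < m)%N, (v < m)%N & ((2 * u).+1 + (1 + (2 * v).+1) <= (2 * m).+1)%N].
  by move=> *; split; lia.
move=> cellK pieceK K0 S01.
pose cnt a b := count (fun s => x a < s < x b) S.
suff H m : forall a b, (a <= b <= N)%N -> (cnt a b <= m)%N ->
    \sum_(a <= j < b) cell_err j <= K * (2 * m).+1%:R.
  by apply: H; [rewrite leqnn|exact: count_size].
elim/ltn_ind: m => m IH a b /andP[ab bN] cm.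
have [abE|nab] := eqVneq a b.
  by rewrite abE big_geq// mulr_ge0.
have {nab}ab' : (a < b)%N by rewrite ltn_neqAle nab.
have [/hasP[s sS sab]|/hasPn nS] := boolP (has (fun s => x a < s < x b) S); last first.
  rewrite (le_trans (pieceK a b _ nS)) ?ab'// ler_peMr// ler1n//.
have [j jN /andP[xjs sxj]] := mesh_cell mx (S01 _ sS).
have aj : (a <= j)%N.
  rewrite leqNgt; apply/negP => ja.
  by have := @mesh_le R N x mx j.+1 a; rewrite ja (leq_trans ab bN) => /(_ isT); lra.
have jb : (j < b)%N.
  rewrite ltnNge; apply/negP => bj.
  by have := @mesh_le R N x mx b j; rewrite bj (ltnW jN) => /(_ isT); lra.
have xab i i' : (i <= i' <= N)%N -> x i <= x i' := @mesh_le R N x mx i i'.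
have xaj : x a <= x j by rewrite xab// aj ltnW.
have xjb : x j.+1 <= x b by rewrite xab// jb.
have cntD : (cnt a j + cnt j.+1 b + count (pred1 s) S <= cnt a b)%N.
  rewrite /cnt; elim: (S) => //= r S' IHS.
  have hd : ((x a < r < x j)%R + (x j.+1 < r < x b)%R + (r == s) <= (x a < r < x b)%R)%N.
    case: (eqVneq r s) => [->|_].
      by rewrite sab [(s < x j)%R]ltNge xjs andbF [(x j.+1 < s)%R]ltNge (ltW sxj).
    case: (boolP (x a < r < x j)) => [r1|_].
      have -> : (x a < r < x b)%R by lra.
      by have -> : (x j.+1 < r < x b) = false by apply/negbTE/negP; lra.
    case: (boolP (x j.+1 < r < x b)) => [r1|//].
    by have -> : (x a < r < x b)%R by lra.
  rewrite (leq_trans _ (leq_add hd IHS))// leq_eqVlt; apply/orP; left.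
  by apply/eqP; ring.
have sc : (0 < count (pred1 s) S)%N by rewrite -has_count has_pred1.
have [cnt1 cnt2 cc] := arith _ _ _ _ _ cntD sc cm.
rewrite (big_cat_nat (n := j))//= ?(ltnW jb)// (big_ltn jb).
have I1 := IH (cnt a j) _ a j _ (leqnn _).
have I2 := IH (cnt j.+1 b) _ j.+1 b _ (leqnn _).
have {}I1 : \sum_(a <= i < j) cell_err i <= K * (2 * cnt a j).+1%:R.
  by apply: I1 => //; rewrite aj ltnW.
have {}I2 : \sum_(j.+1 <= i < b) cell_err i <= K * (2 * cnt j.+1 b).+1%:R.
  by apply: I2 => //; rewrite jb.
have I3 := cellK j jN.
apply: (@le_trans _ _ (K * ((2 * cnt a j).+1 + (1 + (2 * cnt j.+1 b).+1))%:R)).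
  rewrite !natrD !mulrDr mulr1; apply: lerD => //; exact: lerD.
by rewrite ler_wpM2l// ler_nat.
Qed.

End CellError.

Section InterpolationRate.
Variable R : realType.

Lemma rate_eq1 (k l : nat) : minn k l = 0%N -> rate R k l = 1.
Proof. by rewrite /rate => ->; apply/min_idPl; lra. Qed.

Lemma rate_eq32 (k l : nat) : (0 < minn k l)%N -> rate R k l = 3 / 2.
Proof.
rewrite /rate => kl; apply/min_idPr.
have : 2%:R <= (minn k l).+1%:R :> R by rewrite ler_nat.
lra.
Qed.

Lemma powR32_sqr (h : R) : 0 <= h -> (h `^ (3 / 2)) ^+ 2 = h ^+ 3.
Proof.
move=> h0; rewrite -powR_mulrn ?powR_ge0// -powRrM divfK ?pnatr_eq0//.
by rewrite powR_mulrn.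
Qed.

(** The constant is fixed before [v] and [s], hence it is uniform over all times of the exact
    solution and over its translates. *)
Lemma interp_rate (k l p : nat) (c0 M : R) : 0 <= M -> exists2 C : R, 0 <= C &
  forall (v : R -> R) (s L : R) (N : nat) (x : nat -> R) (xi : 'I_k.+1 -> R),
    is_mesh N x -> is_gauss_nodes xi -> periodic v 1 ->
    (forall y z, `|v y - v z| <= M * `|y - z|) ->
    piecewise_regular l p L c0 v ->
    interp_err N x xi (fun y => v (y - s)) <= C * mesh_size N x `^ rate R k l.
Proof.
move=> M0.
have wlip (v : R -> R) (s : R) : (forall y z, `|v y - v z| <= M * `|y - z|) ->
    forall y z, `|v (y - s) - v (z - s)| <= M * `|y - z|.
  by move=> vM y z; rewrite (le_trans (vM _ _))// opprB addrA subrK.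
have [kl0|] := posnP (minn k l).
  exists (2 * M); first exact: mulr_ge0.
  move=> v s L N x xi mx gxi vT vM _.
  rewrite rate_eq1// powRr1; last exact/ltW/mesh_size_gt0.
  apply: interp_err_lip => //; last exact: wlip.
  exact/bmeas_shift/(klipschitz_bmeas vM).
move=> kl_gt0; have := kl_gt0; rewrite leq_min => /andP[k0 l0].
(* The inequality is used for the first derivative, bounded by [M]: its derivative of order l - (l -
   1) = 1 is the second derivative of [w], and its derivative of order l is the one bounded by
   [c0]. *)
have [C C0 HC] := @intermediate_derivatives R l l.-1 (leq_pred _).
have ll1 : (l - l.-1)%N = 1%N by case: (l) l0 => // l' _; rewrite subSnn.
rewrite ll1 in HC.
pose K := 4 * (C * (M + `|c0|)) ^+ 2 + 4 * M ^+ 2.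
have K0 : 0 <= K by rewrite addr_ge0// mulr_ge0// sqr_ge0.
exists (Num.sqrt (K * (2 * p).+1%:R)); first exact: sqrtr_ge0.
move=> v s L N x xi mx gxi vT vM vR.
set w := (fun y => v (y - s)); set h := mesh_size N x.
have h0 : 0 < h := mesh_size_gt0 mx.
have wM : forall y z, `|w y - w z| <= M * `|y - z| := wlip v s vM.
have bw : bmeas w by exact/bmeas_shift/(klipschitz_bmeas vM).
have [S0 S0p S0P] : exists2 S : seq R, (size S <= p)%N &
    forall y, 0 <= y < 1 /\ ~ regular_at l.+1 v y -> y \in S.
  by case: vR => _ _ _ /card_le_seq.
pose S := [seq frac (t + s) | t <- S0].
have regw y : 0 < y < 1 -> y \notin S -> regular_at l.+1 v (y - s).
  move=> y01 yS; apply: contrapT => nr; move/negP: yS; apply.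
  apply/mapP; exists (frac (y - s)).
    by apply: S0P; split; [exact: frac_itv|rewrite regular_at_frac].
  have -> : frac (y - s) + s = y + (- Num.floor (y - s))%:~R.
    by rewrite /frac mulrNz; ring.
  rewrite fracDz frac_id//.
  by case/andP: y01 => /ltW -> ->.
have piece a b : (a < b <= N)%N -> (forall t, t \in S -> ~~ (x a < t < x b)) ->
    \sum_(a <= j < b) cell_err N x xi w j <= 4 * (C * (M + `|c0|)) ^+ 2 * h ^+ 3.
  move=> abN nS; have /andP[ab bN] := abN.
  have xa0 : 0 <= x a by apply: (mesh_ge0 mx); rewrite (leq_trans (ltnW ab)).
  have xb1 : x b <= 1 by apply: (mesh_le1 mx).
  have wreg y : x a < y < x b -> regular_at l.+1 v (y - s).
    move=> yab; apply: regw; first lra.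
    by apply/negP => /nS; rewrite yab.
  have dF i y : (i < l.+1)%N -> x a < y < x b ->
      is_derive y 1 (derive1n i w) (derive1n i.+1 w y).
    move=> il /wreg/regular_at_shift/nbhs_singleton[/(_ i il) dw _].
    by rewrite derive1nS derive1E; exact: derivableP.
  pose F i := derive1n i w.
  have dF2 i y : (i < 2)%N -> x a < y < x b -> is_derive y 1 (F i) (F i.+1 y).
    by move=> i2; apply: dF; apply: leq_trans i2 _; rewrite ltnS.
  have ba1 : x b - x a <= 1 by lra.
  have dG j y : (j < l)%N -> x a < y < x b ->
      is_derive y 1 (F j.+1) (F j.+2 y).
    by move=> jl; exact: dF.
  have F1M y : x a < y < x b -> `|F 1%N y| <= M.
    move=> yab; apply: klipschitz_derive1_le wM.
    by have [] := dF 0%N y isT yab.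
  have Fc0 y : x a < y < x b -> `|F l.+1 y| <= `|c0|.
    move=> yab; rewrite /F derive1n_shift (le_trans _ (ler_norm _))//.
    exact: regular_derivative_bound vT vR (wreg y yab).
  have F2 y : x a < y < x b -> `|F 2%N y| <= C * (M / (x b - x a) + `|c0|).
    rewrite -[x b - x a]expr1.
    exact: (HC (fun i => F i.+1) _ _ _ _ M0 (normr_ge0 _) ba1 dG F1M Fc0).
  exact: (piece_err mx gxi bw C0 M0 (normr_ge0 _) k0 abN erefl dF2 F2).
have total : \sum_(0 <= j < N) cell_err N x xi w j <= K * h ^+ 3 * (2 * size S).+1%:R.
  apply: (cut_at_singular_points mx) => //.
  - move=> j jN; apply: (le_trans (cell_err_lip mx gxi bw jN wM)).
    have hj := le_mesh_size x jN; rewrite -/h in hj.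
    have hj0 : 0 < x j.+1 - x j by rewrite subr_gt0; case: mx => _ _; exact.
    apply: (@le_trans _ _ (4 * M ^+ 2 * h ^+ 3)).
      have M20 : 0 <= 4 * M ^+ 2 by rewrite mulr_ge0// sqr_ge0.
      rewrite [leLHS](_ : _ = 4 * M ^+ 2 * (x j.+1 - x j) ^+ 3); last by ring.
      by rewrite ler_wpM2l// ler_pXn2r ?nnegrE ?(ltW h0) ?(ltW hj0).
    by rewrite ler_wpM2r ?exprn_ge0 ?(ltW h0)// lerDr mulr_ge0// sqr_ge0.
  - move=> a b abN nS; apply: (le_trans (piece a b abN nS)).
    by rewrite ler_wpM2r ?exprn_ge0 ?(ltW h0)// lerDl mulr_ge0// sqr_ge0.
  - by rewrite mulr_ge0// exprn_ge0// ltW.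
  - by move=> _ /mapP[t _ ->]; exact: frac_itv.
rewrite rate_eq32// -(@ler_pXn2r _ 2) ?nnegrE ?L2norm_ge0//; last first.
  by rewrite mulr_ge0 ?sqrtr_ge0 ?powR_ge0.
rewrite interp_err_sqr// exprMn sqr_sqrtr ?mulr_ge0// powR32_sqr ?(ltW h0)//.
rewrite (le_trans total)// mulrAC ler_wpM2r ?exprn_ge0 ?(ltW h0)//.
by rewrite ler_wpM2l// ler_nat ltnS leq_mul2l size_map S0p.
Qed.

End InterpolationRate.

(** * Consistency of the two-point maximum *)

Section LocalMaxima.
Variables (R : realType) (g : R -> R) (M : R).
Hypotheses (gT : periodic g 1) (gM : forall y z, `|g y - g z| <= M * `|y - z|).

Let M0 : 0 <= M.
Proof. by have := gM 1 0; rewrite subr0 normr1 mulr1; exact: le_trans. Qed.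

Lemma derivable_increment (f : R -> R) s : derivable f s 1 ->
  exists2 B : R, 0 <= B & \forall y \near s, `|f y - f s| <= B * `|y - s|.
Proof.
move=> df; pose D := lim ((fun h => h^-1 *: ((f \o shift s) (h *: 1) - f s)) @ (0 : R)^').
have cD : (fun h => h^-1 *: ((f \o shift s) (h *: 1) - f s)) @ (0 : R)^' --> D := df.
exists (`|D| + 1); first by rewrite addr_ge0.
have : \forall h \near (0 : R)^', `|h^-1 *: ((f \o shift s) (h *: 1) - f s)| <= `|D| + 1.
  have /cvgrPdist_le/(_ 1 ltr01) := cD; apply: filterS => h Hh.
  rewrite -lerBlDl (le_trans _ Hh)// distrC; exact: lerB_dist.
move=> /nbhs_ballP[e /= e0 He]; apply/nbhs_ballP; exists e => // y ey.
have [->|ys] := eqVneq y s; first by rewrite !subrr normr0 mulr0.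
have ys0 : y - s != 0 by rewrite subr_eq0.
have := He (y - s); rewrite /ball/= sub0r normrN distrC => /(_ ey ys0).
by rewrite normrZ normfV ler_pdivrMl ?normr_gt0//= [_ *: 1]mulr1 subrK mulrC (distrC s).
Qed.

(** Near [s], g'(s) = 0 and the differentiability of g' at [s] give |g'(y)| <= B |y - s|, then the
    mean value theorem applies. At distance at least [r], the Lipschitz bound M |y - s| is at most
    (M / r) (y - s)^2. The estimate is thus global, as no smallness of the time step is assumed. *)
Lemma local_max_quadratic s : local_max g s -> twice_differentiable_at g s ->
  exists2 K : R, 0 <= K & forall y, `|g y - g s| <= K * (y - s) ^+ 2.
Proof.
move=> gs [dg ddg].
have [B B0 HB] := derivable_increment ddg.
have /nbhs_ballP[r /= r0 Hr] :
    \forall y \near s, [/\ g y <= g s, derivable g y 1 &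
      `|derive1 g y - derive1 g s| <= B * `|y - s|].
  by near=> y; split; near: y.
have inb y : s - r < y < s + r -> ball s r y.
  by rewrite /ball/= => yr; rewrite ltr_norml; lra.
have g's : derive1 g s = 0.
  have sI : s \in `](s - r), (s + r)[ by rewrite in_itv/=; lra.
  have dI y : y \in `](s - r), (s + r)[ -> derivable g y 1.
    by rewrite in_itv/= => /inb /Hr[].
  have mI y : y \in `](s - r), (s + r)[ -> g y <= g s.
    by rewrite in_itv/= => /inb /Hr[].
  have srr : s - r <= s + r by lra.
  by have [_] := derive1_at_max srr dI sI mI; rewrite derive1E.
exists (B + M / r); first by rewrite addr_ge0// divr_ge0// ltW.
move=> y; have [yr|yr] := ltP `|y - s| r; last first.
  rewrite (le_trans (gM _ _))//.
  apply: (@le_trans _ _ (M / r * (y - s) ^+ 2)); last first.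
    by rewrite ler_wpM2r ?sqr_ge0// lerDr.
  rewrite -[(y - s) ^+ 2]real_normK ?num_real// expr2 mulrA ler_wpM2r//.
  by rewrite mulrAC ler_pdivlMr// ler_wpM2l.
apply: (@le_trans _ _ (B * (y - s) ^+ 2)); last first.
  by rewrite ler_wpM2r ?sqr_ge0// lerDl divr_ge0// ltW.
have dG z : s - r < z < s + r -> is_derive z 1 g (derive1 g z).
  by move=> /inb /Hr[_ dz _]; rewrite derive1E; exact: derivableP.
have bnd z : s - r < z < s + r -> `|z - s| <= `|y - s| ->
    `|derive1 g z * (y - s)| <= B * (y - s) ^+ 2.
  move=> /inb /Hr[_ _]; rewrite g's subr0 => Hz zy.
  rewrite normrM -[(y - s) ^+ 2]real_normK ?num_real// expr2 mulrA ler_wpM2r//.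
  by rewrite (le_trans Hz)// ler_wpM2l.
move: yr; rewrite ltr_norml => /andP[y1 y2].
have [ys|sy|->] := ltgtP y s; last by rewrite !subrr normr0 expr0n mulr0.
- have [||z /andP[z1 z2] E] := is_derive_MVT dG _ ys _; [lra|lra|].
  rewrite distrC E -opprB mulrN normrN bnd//; first lra.
  by rewrite !ltr0_norm; lra.
- have [||z /andP[z1 z2] ->] := is_derive_MVT dG _ sy _; [lra|lra|].
  by rewrite bnd//; [lra|rewrite !gtr0_norm; lra].
Unshelve. all: by end_near. Qed.

Lemma local_max_shift s t : local_max g (s - t) -> local_max (fun y => g (y - t)) s.
Proof. exact: near_shift. Qed.

Lemma local_max_frac s : local_max g s -> local_max g (frac s).
Proof.
move=> gs; have := @local_max_shift (frac s) (- (Num.floor s)%:~R).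
rewrite -mulrNz periodic_shiftz//; apply.
by rewrite /frac mulrNz opprK subrK.
Qed.

(** Modulo 1 there are finitely many local maxima, so their constants can be added up. *)
Lemma uniform_quadratic q : Delta2 q g ->
  exists2 K : R, 0 <= K &
    forall s y, local_max g s -> `|g y - g s| <= K * (y - s) ^+ 2.
Proof.
move=> [/card_le_seq[S _ SP] td].
suff [K K0 HK] : exists2 K : R, 0 <= K & forall s y, s \in S -> local_max g s ->
    `|g y - g s| <= K * (y - s) ^+ 2.
  exists K => // s y gs; have := HK (frac s) (y - (Num.floor s)%:~R).
  rewrite periodic_frac// -mulrNz periodicz// mulrNz /frac.
  have -> : y - (Num.floor s)%:~R - (s - (Num.floor s)%:~R) = y - s by ring.
  apply; last exact: local_max_frac.
  by apply: SP; split; [exact: frac_itv|exact: local_max_frac].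
elim: S {SP} => [|s S [K K0 HK]]; first by exists 0.
have [gs|ngs] := pselect (local_max g s); last first.
  exists K => // r y; rewrite inE => /predU1P[->//|]; exact: HK.
have [K' K'0 HK'] := local_max_quadratic gs (td s gs).
exists (K + K'); first exact: addr_ge0.
move=> r y; rewrite inE => /predU1P[-> _|rS gr].
  by rewrite (le_trans (HK' y))// ler_wpM2r ?sqr_ge0// lerDr.
by rewrite (le_trans (HK r y rS gr))// ler_wpM2r ?sqr_ge0// lerDl.
Qed.

End LocalMaxima.

Section TwoPointMax.
Variables (R : realType) (c : R) (g : R -> R) (M : R).
Hypotheses (c0 : 0 < c) (gT : periodic g 1).
Hypothesis gM : forall y z, `|g y - g z| <= M * `|y - z|.

Lemma two_point_max_le dt y : 0 <= dt ->
  two_point_max c dt g y <= running_max c g dt y.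
Proof.
move=> dt0; rewrite /two_point_max ge_max; apply/andP; split.
  have := @running_max_ub R c g M gT gM dt y 0.
  by rewrite mulr0 subr0; apply; rewrite lexx.
by apply: (@running_max_ub R c g M gT gM); rewrite dt0 lexx.
Qed.

(** A maximiser at either end of the window would make the two maxima equal; an interior one is a
    local maximum of [g], since c > 0 makes the window a neighbourhood of it. *)
Lemma running_max_interior dt y : 0 < dt ->
  two_point_max c dt g y != running_max c g dt y ->
  exists s, [/\ local_max g s, y - c * dt < s < y & running_max c g dt y = g s].
Proof.
move=> dt0 ne.
have cont : {within `[0, dt], continuous (fun t => g (y - c * t))}.
  apply: continuous_subspaceT => t.
  apply: (@continuous_comp _ _ _ (fun t => y - c * t) g).
    by apply: cvgB; [exact: cvg_cst|apply: cvgM; [exact: cvg_cst|exact: cvg_id]].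
  exact: (klipschitz_continuous gM).
have [t] := EVT_max (ltW dt0) cont.
rewrite in_itv/= => /andP[t0 tdt] tmax.
have rE : running_max c g dt y = g (y - c * t).
  apply/eqP; rewrite eq_le (@running_max_ub R c g M gT gM) ?t0// andbT.
  by apply: (@running_max_le R c g M gT gM) => [|s sI]; [exact: ltW|exact: tmax].
have le2 := two_point_max_le y (ltW dt0).
have tn0 : t != 0.
  apply: contra_neq ne => tE; apply/eqP; rewrite eq_le le2 rE tE mulr0 subr0.
  by rewrite /two_point_max le_max lexx.
have tndt : t != dt.
  apply: contra_neq ne => tE; apply/eqP; rewrite eq_le le2 rE tE.
  by rewrite /two_point_max le_max lexx orbT.
have t_gt0 : 0 < t by rewrite lt_def tn0.
have t_lt : t < dt by rewrite lt_neqAle tndt.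
have ct0 : 0 < c * t by rewrite mulr_gt0.
have ctd : c * t < c * dt by rewrite ltr_pM2l.
exists (y - c * t); split => //; last lra.
have sI : y - c * t \in `](y - c * dt), y[ by rewrite in_itv/=; lra.
near=> z.
have : z \in `](y - c * dt), y[ by near: z; exact: near_in_itvoo sI.
rewrite in_itv/= => zI.
have -> : z = y - c * ((y - z) / c) by field; rewrite gt_eqF.
apply: tmax; rewrite in_itv/= ler_pdivlMr// mul0r ler_pdivrMr//.
by rewrite (mulrC dt); lra.
Unshelve. all: by end_near. Qed.

Section MeshStrip.
Variables (N : nat) (x : nat -> R).
Hypothesis mx : is_mesh N x.
Local Notation h := (mesh_size N x).

(* Clip the mesh points to [a - h, b + h] and telescope. *)
Lemma cells_meeting_interval (a b : R) : a <= b ->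
  \sum_(j < N) ((x j < b) && (a < x j.+1))%R%:R * (x j.+1 - x j) <=
  b - a + 2 * h.
Proof.
move=> ab; have h0 := mesh_size_gt0 mx.
pose phi t := Num.min (Num.max t (a - h)) (b + h).
have phi_lo t : a - h <= phi t by rewrite le_min le_max lexx orbT/=; lra.
have phi_hi t : phi t <= b + h by rewrite ge_min lexx orbT.
apply: (@le_trans _ _ (\sum_(0 <= j < N) (phi (x j.+1) - phi (x j)))); last first.
  rewrite telescope_sumr//; have := phi_lo (x 0%N); have := phi_hi (x N); lra.
rewrite big_mkord; apply: ler_sum => j _.
have hj := le_mesh_size x (ltn_ord j).
have xj : x j < x j.+1 by case: mx => _ _; exact.
case: (boolP (_ && _)) => [/andP[jb aj]|_]; last first.
  rewrite mul0r subr_ge0 /phi.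
  have mm : Num.max (x j) (a - h) <= Num.max (x j.+1) (a - h).
    by rewrite ge_max !le_max (ltW xj) lexx orbT.
  by rewrite le_min !ge_min mm lexx orbT.
have phi_id t : a - h <= t -> t <= b + h -> phi t = t.
  by move=> t1 t2; rewrite /phi (max_idPl t1) (min_idPl t2).
(* A cell meeting the interval has both ends in [[a - h, b + h]], where clipping changes nothing;
   the other cells contribute nonnegative increments. *)
by rewrite mul1r !phi_id//; lra.
Qed.

Lemma sum_cells : \sum_(j < N) (x j.+1 - x j) = 1.
Proof.
rewrite -(big_mkord xpredT (fun j => x j.+1 - x j)) (mesh_lengths (N := N)) ?leqnn//.
by case: mx => -> -> _; rewrite subr0.
Qed.

Lemma consistency_l2 (k : nat) (xi : 'I_k.+1 -> R) (e : R -> R) (E D : R)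
    (bad : 'I_N -> bool) : is_gauss_nodes xi -> 0 <= E ->
  (forall (j : 'I_N) a, `|e (gauss_point x xi j a)| <= E * (bad j)%:R) ->
  \sum_(j < N) (bad j)%:R * (x j.+1 - x j) <= D ->
  l2norm N x xi e <= E * Num.sqrt D.
Proof.
move=> gxi E0 eE badD.
have hj0 (j : 'I_N) : 0 <= x j.+1 - x j.
  by rewrite subr_ge0 ltW//; case: mx => _ _; exact.
have D0 : 0 <= D.
  by rewrite (le_trans _ badD)// sumr_ge0// => j _; rewrite mulr_ge0.
rewrite -[E]ger0_norm// -sqrtr_sqr -sqrtrM ?sqr_ge0// ler_wsqrtr//.
apply: (@le_trans _ _ (E ^+ 2 * \sum_(j < N) (bad j)%:R * (x j.+1 - x j))); last first.
  by rewrite ler_wpM2l ?sqr_ge0.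
rewrite mulr_sumr; apply: ler_sum => j _.
apply: (@le_trans _ _ (\sum_(a < k.+1) gauss_weight xi a *
    (E ^+ 2 * ((bad j)%:R * (x j.+1 - x j))))); last first.
  by rewrite -mulr_suml (sum_gauss_weight gxi) mul1r.
apply: ler_sum => a _; rewrite -mulrA ler_wpM2l ?gauss_weight_ge0//.
rewrite mulrA ler_wpM2r//.
have -> : E ^+ 2 * (bad j)%:R = (E * (bad j)%:R) ^+ 2.
  by rewrite exprMn; congr (_ * _); case: (bad j); rewrite ?expr1n ?expr0n.
by rewrite ler_pXn2r ?nnegrE ?mulr_ge0.
Qed.

End MeshStrip.

(* The error vanishes on every cell that meets no interval (s, s + c dt) with s
   a local maximum; for c dt < 1 only the s in (-1, 1) matter, and the case
   1 <= c dt is trivial since the cells have total length 1. *)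
Lemma two_point_max_consistency q : Delta2 q g ->
  exists2 C : R, 0 <= C &
  forall (k N : nat) (x : nat -> R) (xi : 'I_k.+1 -> R) (dt : R),
    is_mesh N x -> is_gauss_nodes xi -> 0 < dt ->
    l2norm N x xi (fun y => two_point_max c dt g y - running_max c g dt y) <=
    C * dt ^+ 2 * Num.sqrt (dt + mesh_size N x).
Proof.
move=> Dg; have [K K0 HK] := uniform_quadratic gT gM Dg.
case: Dg => /card_le_seq[S Sq SP] _.
(* Representatives in [0, 1) and in [-1, 0): the window behind a point of (0, 1) may cross 0, but
   not -1 when [c * dt < 1]. *)
pose S2 := S ++ [seq s - 1 | s <- S].
(* At most 2q intervals, each met by cells of total length at most c dt + 2h <= (c + 2) (dt + h).
   The extra 1 keeps the first factor at least 1, as the case [1 <= c * dt] requires. *)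
pose D := (2 * q).+1%:R * (c + 2).
have c20 : 0 <= c + 2 by rewrite addr_ge0// ltW.
have D0 : 0 <= D by rewrite mulr_ge0.
exists (K * c ^+ 2 * Num.sqrt D); first by rewrite mulr_ge0 ?sqrtr_ge0// mulr_ge0// sqr_ge0.
move=> k N x xi dt mx gxi dt0; set h := mesh_size N x.
have h0 : 0 < h := mesh_size_gt0 mx.
have cdt : 0 < c * dt by rewrite mulr_gt0.
pose e y := two_point_max c dt g y - running_max c g dt y.
pose bad (j : 'I_N) := [exists a, e (gauss_point x xi j a) != 0].
have hj0 (j : 'I_N) : 0 <= x j.+1 - x j.
  by rewrite subr_ge0 ltW//; case: mx => _ _; exact.
have xj_lt (j : 'I_N) : x j < x j.+1 by case: mx => _ _; exact.
pose E := K * (c * dt) ^+ 2.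
have E0 : 0 <= E by rewrite mulr_ge0 ?sqr_ge0.
have -> : K * c ^+ 2 * Num.sqrt D * dt ^+ 2 * Num.sqrt (dt + h) =
    E * Num.sqrt (D * (dt + h)).
  by rewrite (sqrtrM (dt + h) D0) /E; ring.
have dth : 0 <= dt + h by rewrite addr_ge0// ltW.
apply: (@consistency_l2 N x mx k xi e E _ bad gxi E0) => [j a|].
  have [e0|en0] := eqVneq (e (gauss_point x xi j a)) 0.
    by rewrite e0 normr0 mulr_ge0.
  have -> : bad j by apply/existsP; exists a.
  rewrite mulr1; set y := gauss_point _ _ _ _ in en0 *.
  have [|s [gs sI rE]] := @running_max_interior dt y dt0.
    by move: en0; rewrite subr_eq0.
  have e_le0 : e y <= 0 by rewrite subr_le0 two_point_max_le// ltW.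
  rewrite ler0_norm// /e opprB rE.
  apply: (@le_trans _ _ (g s - g y)).
    (* The two-point maximum is at least [g y], so the error is at most [g s - g y]. *)
    by rewrite lerB// /two_point_max le_max lexx.
  rewrite (le_trans (ler_norm _))// distrC (le_trans (HK s y gs))// ler_wpM2l//.
  by rewrite ler_pXn2r ?nnegrE ?(ltW cdt)//; lra.
have [cdt1|cdt1] := leP 1 (c * dt).
  apply: (@le_trans _ _ 1).
    rewrite -[leRHS](sum_cells mx); apply: ler_sum => j _.
    by case: (bad j); rewrite ?mul1r ?mul0r.
  apply: (le_trans cdt1); rewrite /D.
  have q1 : 1 <= (2 * q).+1%:R :> R by rewrite ler1n.
  apply: (@le_trans _ _ (1 * (c + 2) * (dt + h))).
    by rewrite mul1r mulrDr !mulrDl; have := mulr_gt0 c0 h0; lra.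
  by rewrite ler_wpM2r// ler_wpM2r.
have badS (j : 'I_N) : (bad j)%:R <=
    \sum_(s <- S2) ((x j < s + c * dt) && (s < x j.+1))%R%:R :> R.
  case: (boolP (bad j)) => [/existsP[a en0]|_]; last by rewrite sumr_ge0.
  set y := gauss_point _ _ _ _ in en0.
  have [|s [gs sI _]] := @running_max_interior dt y dt0.
    by move: en0; rewrite subr_eq0.
  have yj : x j < y < x j.+1 := gauss_point_in gxi a (xj_lt j).
  have x0 := mesh_ge0 mx (ltnW (ltn_ord j)).
  have x1 := mesh_le1 mx (ltn_ord j).
  have sS2 : s \in S2.
    rewrite mem_cat; have [s0|s0] := leP 0 s.
      by rewrite SP//; split=> //; lra.
    apply/orP; right; apply/mapP; exists (s + 1); last by rewrite addrK.
    apply: SP; split; first lra.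
    have := @local_max_shift R g (s + 1) 1; rewrite addrK => /(_ gs).
    by rewrite (periodic_shiftz 1 gT).
  rewrite (big_rem s sS2)/=.
  have -> : (x j < s + c * dt) && (s < x j.+1) by lra.
  by rewrite lerDl sumr_ge0.
apply: (@le_trans _ _ (\sum_(j < N) \sum_(s <- S2)
    ((x j < s + c * dt) && (s < x j.+1))%R%:R * (x j.+1 - x j))).
  by apply: ler_sum => j _; rewrite -mulr_suml ler_wpM2r.
rewrite exchange_big/=.
apply: (@le_trans _ _ (\sum_(s <- S2) (c * dt + 2 * h))).
  apply: ler_sum => s _.
  apply: (le_trans (cells_meeting_interval mx _)); first by rewrite lerDl ltW.
  by rewrite [_ - s]addrC addKr.
rewrite big_const_seq count_predT iter_addr_0 -[leLHS]mulr_natl /D -mulrA.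
have szS : (size S2 <= (2 * q).+1)%N.
  by rewrite size_cat size_map addnn -mul2n leqW// leq_mul2l Sq.
have ch : 0 <= c * dt + 2 * h by lra.
apply: ler_pM; rewrite ?ler_nat// mulrDr !mulrDl.
have := mulr_gt0 c0 h0; lra.
Qed.

End TwoPointMax.

(** * Convergence for an arbitrary discrete obstacle, and the three estimates *)

Lemma sldg_convergence (R : realType) (c : R) (k l : nat) (u0 g : R -> R)
    (p : nat) (L c0 : R) :
  periodic u0 1 -> periodic g 1 -> lipschitz u0 -> lipschitz g ->
  exists2 C : R, 0 <= C &
    forall T : R, 0 < T -> not_shattering l c u0 g p L c0 T ->
    forall (N : nat) (x : nat -> R) (xi : 'I_k.+1 -> R),
      is_mesh N x -> is_gauss_nodes xi ->
    forall dt : R, 0 < dt <= T ->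
    forall (gt : R -> R) (uh : nat -> R -> R), is_sldg N x xi c dt u0 gt uh ->
    forall n : nat, n%:R * dt <= T ->
      L2norm (fun y => uh n y - exact_sol c u0 g (n%:R * dt) y) <=
        C * T * (mesh_size N x `^ rate R k l / dt) +
        C * T * (l2norm N x xi (fun y => gt y - running_max c g dt y) / dt).
Proof.
move=> u0T gT /klipschitzP[M1 M10 u0M1] /klipschitzP[M2 M20 gM2].
pose M := M1 + M2; have M_ge0 : 0 <= M by rewrite addr_ge0// ltW.
have u0M y z : `|u0 y - u0 z| <= M * `|y - z|.
  by rewrite (le_trans (u0M1 y z))// ler_wpM2r// lerDl ltW.
have gM y z : `|g y - g z| <= M * `|y - z|.
  by rewrite (le_trans (gM2 y z))// ler_wpM2r// lerDr ltW.
have [C C0 HC] := interp_rate k l p c0 M_ge0.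
(* One constant for both terms: [3 * C] for the interpolation errors, 1 for the obstacle error. *)
exists (3 * C + 1); first by rewrite addr_ge0// mulr_ge0.
move=> T T0 ns N x xi mx gxi dt /andP[dt0 dtT] gt uh sldg n nT.
set r := mesh_size N x `^ rate R k l; set d := l2norm _ _ _ _.
have err t s : 0 <= t <= T ->
    interp_err N x xi (fun y => exact_sol c u0 g t (y - s)) <= C * r.
  move=> tT; apply: HC (ns t tT) => //; first exact: exact_sol_periodic.
  by move=> y z; apply: exact_sol_lip => //; case/andP: tT.
apply: (le_trans (sldg_error u0T gT u0M gM mx gxi dt0 dtT err sldg nT)).
rewrite -/d.
have Tdr : 0 <= T * (r / dt) by rewrite mulr_ge0 ?divr_ge0 ?powR_ge0// ltW.
have Tdd : 0 <= C * (T * (d / dt)).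
  by rewrite !mulr_ge0 ?invr_ge0 ?sqrtr_ge0// ltW.
have -> : 3 * (T / dt * (C * r)) + T / dt * d =
    3 * C * (T * (r / dt)) + T * (d / dt) by field; rewrite gt_eqF.
have -> : (3 * C + 1) * T * (r / dt) + (3 * C + 1) * T * (d / dt) =
    3 * C * (T * (r / dt)) + T * (d / dt) + (T * (r / dt) +
    3 * (C * (T * (d / dt)))) by field; rewrite gt_eqF.
by rewrite lerDl addr_ge0// mulr_ge0.
Qed.

(* The constants are chosen after c, k, l, u0, g and the regularity constants
   p, L, c0 of the exact solution, and before T, the mesh, dt and n. *)
Theorem theorem4p3 (R : realType) (c : R) (k l : nat) (u0 g : R -> R)
    (p : nat) (L c0 : R)
    (hc : 0 < c)
    (u0_per : periodic u0 1) (g_per : periodic g 1)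
    (u0_lip : lipschitz u0) (g_lip : lipschitz g) :
  [/\
   exists2 C : R, 0 <= C &
     forall T : R, 0 < T -> not_shattering l c u0 g p L c0 T ->
     forall (N : nat) (x : nat -> R) (xi : 'I_k.+1 -> R),
       is_mesh N x -> is_gauss_nodes xi ->
     forall dt : R, 0 < dt <= T ->
     forall gt : R -> R,
       gt = running_max c g dt \/ gt = two_point_max c dt g ->
     forall uh : nat -> R -> R, is_sldg N x xi c dt u0 gt uh ->
     forall n : nat, n%:R * dt <= T ->
       L2norm (uh n \- exact_sol c u0 g (n%:R * dt)) <=
         C * T * (mesh_size N x `^ rate R k l / dt) +
         C * T * (l2norm N x xi (gt \- running_max c g dt) / dt),
   exists2 C : R, 0 <= C &
     forall T : R, 0 < T -> not_shattering l c u0 g p L c0 T ->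
     forall (N : nat) (x : nat -> R) (xi : 'I_k.+1 -> R),
       is_mesh N x -> is_gauss_nodes xi ->
     forall dt : R, 0 < dt <= T ->
     forall uh : nat -> R -> R,
       is_sldg N x xi c dt u0 (running_max c g dt) uh ->
     forall n : nat, n%:R * dt <= T ->
       L2norm (uh n \- exact_sol c u0 g (n%:R * dt)) <=
         C * T * (mesh_size N x `^ rate R k l / dt) &
   forall q : nat, (1 <= q)%N -> Delta2 q g ->
   exists2 C : R, 0 <= C &
     forall T : R, 0 < T -> not_shattering l c u0 g p L c0 T ->
     forall (N : nat) (x : nat -> R) (xi : 'I_k.+1 -> R),
       is_mesh N x -> is_gauss_nodes xi ->
     forall dt : R, 0 < dt <= T ->
     forall uh : nat -> R -> R,
       is_sldg N x xi c dt u0 (two_point_max c dt g) uh ->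
     forall n : nat, n%:R * dt <= T ->
       L2norm (uh n \- exact_sol c u0 g (n%:R * dt)) <=
         C * T * (mesh_size N x `^ rate R k l / dt) +
         C * T * dt * Num.sqrt (dt + mesh_size N x)].
Proof.
have [C C0 HC] := sldg_convergence c k l p L c0 u0_per g_per u0_lip g_lip.
split.
- exists C => // T T0 ns N x xi mx gxi dt dtT gt _ uh sldg n nT.
  exact: HC ns _ _ _ mx gxi _ dtT _ _ sldg _ nT.
- exists C => // T T0 ns N x xi mx gxi dt dtT uh sldg n nT.
  apply: (le_trans (HC _ T0 ns _ _ _ mx gxi _ dtT _ _ sldg _ nT)).
  have -> : l2norm N x xi (fun y => running_max c g dt y - running_max c g dt y)
      = 0.
    rewrite l2normE big1 ?sqrtr0// => j _; rewrite big1// => a _.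
    by rewrite subrr expr0n mulr0.
  by rewrite mul0r mulr0 addr0.
- move=> q _ Dg; have [M M0 gM] := klipschitzP g_lip.
  have [C' C'0 HC'] := two_point_max_consistency hc g_per gM Dg.
  (* [C] covers the interpolation term. [C * C'] covers the consistency term, whose factor [dt ^+ 2]
     loses one power in the division by [dt]. *)
  exists (C + C * C'); first by rewrite addr_ge0// mulr_ge0.
  move=> T T0 ns N x xi mx gxi dt dtT uh sldg n nT.
  have dt0 : 0 < dt by case/andP: dtT.
  apply: (le_trans (HC _ T0 ns _ _ _ mx gxi _ dtT _ _ sldg _ nT)).
  have CT : 0 <= C * T by rewrite mulr_ge0// ltW.
  have CCT : 0 <= C * C' * T by rewrite !mulr_ge0// ltW.
  apply: lerD.
    have hr : 0 <= mesh_size N x `^ rate R k l / dt.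
      by rewrite divr_ge0 ?powR_ge0 ?(ltW dt0).
    by rewrite (ler_wpM2r hr)// (ler_wpM2r (ltW T0))// lerDl mulr_ge0.
  apply: (@le_trans _ _
      (C * T * (C' * dt ^+ 2 * Num.sqrt (dt + mesh_size N x) / dt))).
    by rewrite ler_wpM2l// ler_wpM2r ?invr_ge0 ?(ltW dt0)// HC'.
  have -> : C * T * (C' * dt ^+ 2 * Num.sqrt (dt + mesh_size N x) / dt) =
      C * C' * T * dt * Num.sqrt (dt + mesh_size N x).
    by field; rewrite gt_eqF.
  rewrite ler_wpM2r ?sqrtr_ge0// ler_wpM2r ?(ltW dt0)// ler_wpM2r ?(ltW T0)//.
  by rewrite lerDr.
Qed.
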